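(* Let $S$ be a Dirac bundle over a compact Riemannian $n$-manifold $M$, with Dirac operator $D$ and Weitzenböck curvature operator $\mathcal{R}$. Let $\sigma\in\Gamma(S)$ and $\lambda\in\mathbb{R}$. The following are equivalent: (i) $\sigma$ is a Killing section with constant $\lambda$; (ii) $D\sigma=-n\lambda\sigma$ and $\mathcal{R}\sigma=\lambda^2n(n-1)\sigma$.
   Context: Manifolds are smooth without boundary. $M$ is an $n$-dimensional Riemannian manifold and $\mathrm{C}\ell(M)$ is its Clifford bundle (convention $X\cdot X=-|X|^2$ for $X\in T_pM$), with the naturally induced metric and connection. A Dirac bundle over $M$ is a (finite-rank real) vector bundle $S\to M$ that is a left $\mathrm{C}\ell(M)$-module, together with a euclidean fibre metric $\langle\cdot,\cdot\rangle$ and a metric connection $\nabla$ such that: (i) $\langle X\cdot\sigma,\tau\rangle+\langle\sigma,X\cdot\tau\rangle=0$ for all $X\in T_pM$, $\sigma,\tau\in S_p$; (ii) $\nabla(a\cdot\sigma)=(\nabla a)\cdot\sigma+a\cdot\nabla\sigma$ for all $a\in\Gamma(\mathrm{C}\ell(M))$, $\sigma\in\Gamma(S)$. $\Gamma(S)$ denotes smooth sections. In a local orthonormal frame $e_1,\dots,e_n$ of $TM$, the Dirac operator is $D\sigma=\sum_{i}e_i\cdot\nabla_{e_i}\sigma$ and the Weitzenböck curvature operator is $\mathcal{R}\sigma=\sum_{i<j}e_i\cdot e_j\cdot R(e_i,e_j)\sigma$, where $R(X,Y)=\nabla_X\nabla_Y-\nabla_Y\nabla_X-\nabla_{[X,Y]}$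 is the curvature of $\nabla$ on $S$. A section $\sigma$ is a Killing section with constant $\lambda$ if $\nabla_X\sigma=\lambda X\cdot\sigma$ for all $X\in TM$. *)

(* Defs.v *)
From HB Require Import structures.
From mathcomp Require Import all_boot all_order all_algebra.
From mathcomp Require Import all_classical all_reals all_analysis.

Set Implicit Arguments.
Unset Strict Implicit.
Unset Printing Implicit Defensive.

Import Order.TTheory GRing.Theory Num.Theory.
Import numFieldNormedType.Exports.

Local Open Scope classical_set_scope.
Local Open Scope ring_scope.

(** * Smooth manifolds *)

(* [f] is of class C^k on the open set [U]; the partial derivatives are the
   directional derivatives along the canonical basis of R^n. *)
Fixpoint class_C (R : realType) (n : nat) (V : normedModType R) (k : nat)
    (U : set 'rV[R]_n) (f : 'rV[R]_n -> V) : Prop :=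
  (forall x, U x -> {for x, continuous f}) /\
  if k is k'.+1 then
    forall i : 'I_n,
      (forall x, U x -> derivable f x (delta_mx 0 i)) /\
      class_C k' U (fun x => 'D_(delta_mx 0 i) f x)
  else True.

Definition smooth_on (R : realType) (n : nat) (V : normedModType R)
    (U : set 'rV[R]_n) (f : 'rV[R]_n -> V) : Prop :=
  forall k, class_C k U f.

(* [cmap] is a homeomorphism from the open set [cdom] onto an open subset of
   R^n, with inverse [cinv]; both are total functions whose values elsewhere are
   irrelevant. *)
Record chart (R : realType) (n : nat) (M : topologicalType) := Chart {
  cdom : set M;
  cmap : M -> 'rV[R]_n;
  cinv : 'rV[R]_n -> M;
  cdom_open : open cdom;
  cimg_open : open (cmap @` cdom);
  cmapK : forall p, cdom p -> cinv (cmap p) = p;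
  cmap_continuous : forall p, cdom p -> {for p, continuous cmap};
  cinv_continuous : forall p, cdom p -> {for cmap p, continuous cinv}
}.

(* The atlas need not be maximal: it determines the smooth structure. *)
Record manifold (R : realType) (n : nat) := Manifold {
  mcarrier :> topologicalType;
  atlas : set (chart R n mcarrier);
  m_hausdorff : hausdorff_space mcarrier;
  m_second_countable : @second_countable mcarrier;
  atlas_cover : forall p : mcarrier, exists c, atlas c /\ cdom c p;
  atlas_compat : forall c c', atlas c -> atlas c' ->
    smooth_on (cmap c @` (cdom c `&` cdom c')) (cmap c' \o cinv c)
}.

Definition chart_at (R : realType) (n : nat) (M : manifold R n) (p : M) :
    chart R n M := sval (cid (atlas_cover p)).

Definition smooth_fun (R : realType) (n : nat) (M : manifold R n)
    (V : normedModType R) (U : set M) (f : M -> V) : Prop :=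
  forall c, atlas c -> smooth_on (cmap c @` (U `&` cdom c)) (f \o cinv c).

(* T_pM, represented by the coordinates of tangent vectors in the preferred
   chart [chart_at p].  Neither addition nor equality of elements of [tangent p]
   and [tangent q] is meaningful for p <> q: passing to another chart goes
   through [tcoord]. *)
Definition tangent (R : realType) (n : nat) (M : manifold R n) (p : M) :
  lmodType R := 'rV[R]_n.

(* The derivative v(f) of a function (possibly vector-valued) along v : T_pM. *)
Definition tderive (R : realType) (n : nat) (M : manifold R n)
    (V : normedModType R) (p : M) (v : tangent p) (f : M -> V) : V :=
  let c := chart_at p in 'D_(v : 'rV[R]_n) (f \o cinv c) (cmap c p).

(* The coordinates of v : T_pM in the chart [c], i.e. the image of v under the
   differential of [cmap c] at p. *)
Definition tcoord (R : realType) (n : nat) (M : manifold R n)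
    (c : chart R n M) (p : M) (v : tangent p) : 'rV[R]_n :=
  tderive v (cmap c).

Definition vector_field (R : realType) (n : nat) (M : manifold R n) : Type :=
  forall p : M, tangent p.

Definition smooth_vf (R : realType) (n : nat) (M : manifold R n)
    (U : set M) (X : vector_field M) : Prop :=
  forall c, atlas c -> smooth_fun (U `&` cdom c) (fun p => tcoord c (X p)).

(* [X, Y]^j = X(Y^j) - Y(X^j) in the preferred chart at p. *)
Definition lie_bracket (R : realType) (n : nat) (M : manifold R n)
    (X Y : vector_field M) : vector_field M := fun p =>
  let c := chart_at p in
  tderive (X p) (fun q => tcoord c (Y q)) -
  tderive (Y p) (fun q => tcoord c (X q)).

(** * Vector bundles *)

(* A local trivialization of the family of vector spaces [E], given as a frame
   over the open set [fdom]. *)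
Record local_frame (R : realType) (n : nat) (M : manifold R n)
    (E : M -> lmodType R) := LocalFrame {
  fdom : set M;
  frank : nat;
  fsec : 'I_frank -> forall p, E p;
  fdom_open : open fdom;
  fsec_basis : forall p, fdom p -> forall v : E p,
    exists! a : 'rV[R]_frank, v = \sum_(i < frank) a 0 i *: fsec i p
}.

Arguments fsec {R n M E} l i p.

Definition smooth_in_frame (R : realType) (n : nat) (M : manifold R n)
    (E : M -> lmodType R) (f : local_frame E) (U : set M)
    (s : forall p, E p) : Prop :=
  exists2 a : M -> 'rV[R]_(frank f), smooth_fun (U `&` fdom f) a &
    forall p, U p -> fdom f p ->
      s p = \sum_(i < frank f) a p 0 i *: fsec f i p.

(* [F] is a trivializing family of local frames with smooth transition
   matrices, i.e. it makes [E] a smooth vector bundle of finite (locally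
   constant) rank. *)
Definition bundle_atlas (R : realType) (n : nat) (M : manifold R n)
    (E : M -> lmodType R) (F : set (local_frame E)) : Prop :=
  (forall p, exists f, F f /\ fdom f p) /\
  (forall f f', F f -> F f' ->
     forall i, smooth_in_frame f' (fdom f) (fsec f i)).

Definition smooth_section (R : realType) (n : nat) (M : manifold R n)
    (E : M -> lmodType R) (F : set (local_frame E)) (U : set M)
    (s : forall p, E p) : Prop :=
  forall f, F f -> smooth_in_frame f U s.

(* In the next two records [sm U s] expresses that s is smooth on the open set U;
   it is [smooth_vf] for the tangent bundle and [smooth_section F] for a bundle
   given by local frames. *)

Record fiber_metric (R : realType) (n : nat) (M : manifold R n)
    (E : M -> lmodType R) (sm : set M -> (forall p, E p) -> Prop)
    (h : forall p, E p -> E p -> R) : Prop := FiberMetric {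
  fm_sym : forall p (s t : E p), h p s t = h p t s;
  fm_linear : forall p (a : R) (s s' t : E p),
    h p (a *: s + s') t = a * h p s t + h p s' t;
  fm_pos : forall p (s : E p), s != 0 -> 0 < h p s s;
  fm_smooth : forall U s t, open U -> sm U s -> sm U t ->
    smooth_fun U (fun p => h p (s p) (t p))
}.

(* A connection, as an operator on sections over open sets: [nabla p v s] is
   nabla_v s for v : T_pM and s a section smooth near p.  It depends only on the
   germ of s; its values on sections that are not smooth near p are
   irrelevant. *)
Record connection (R : realType) (n : nat) (M : manifold R n)
    (E : M -> lmodType R) (sm : set M -> (forall p, E p) -> Prop)
    (nabla : forall p, tangent p -> (forall q : M, E q) -> E p) : Prop :=
    Connection {
  cn_smooth : forall U X s, open U -> smooth_vf U X -> sm U s ->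
    sm U (fun p => nabla p (X p) s);
  cn_linear : forall U p (a : R) (u v : tangent p) s,
    open U -> U p -> sm U s ->
    nabla p (a *: u + v) s = a *: nabla p u s + nabla p v s;
  cn_add : forall U p (v : tangent p) s t,
    open U -> U p -> sm U s -> sm U t ->
    nabla p v (fun q => s q + t q) = nabla p v s + nabla p v t;
  cn_leibniz : forall U p (v : tangent p) (f : M -> R) s,
    open U -> U p -> smooth_fun U f -> sm U s ->
    nabla p v (fun q => f q *: s q) = tderive v f *: s p + f p *: nabla p v s;
  cn_local : forall U p (v : tangent p) s t,
    open U -> U p -> sm U s -> (forall q, U q -> s q = t q) ->
    nabla p v s = nabla p v t
}.

Definition metric_connection (R : realType) (n : nat) (M : manifold R n)
    (E : M -> lmodType R) (sm : set M -> (forall p, E p) -> Prop)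
    (h : forall p, E p -> E p -> R)
    (nabla : forall p, tangent p -> (forall q : M, E q) -> E p) : Prop :=
  connection sm nabla /\
  forall U p (v : tangent p) s t, open U -> U p -> sm U s -> sm U t ->
    tderive v (fun q => h q (s q) (t q)) =
    h p (nabla p v s) (t p) + h p (s p) (nabla p v t).

(* R(X, Y) s; the vector fields and the section may be defined only near p. *)
Definition curvature (R : realType) (n : nat) (M : manifold R n)
    (E : M -> lmodType R)
    (nabla : forall p, tangent p -> (forall q : M, E q) -> E p)
    (X Y : vector_field M) (s : forall q, E q) (p : M) : E p :=
  nabla p (X p) (fun q => nabla q (Y q) s) -
  nabla p (Y p) (fun q => nabla q (X q) s) -
  nabla p (lie_bracket X Y p) s.

(** * Riemannian manifolds *)

Record riemannian_metric (R : realType) (n : nat) (M : manifold R n) :=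
    RiemannianMetric {
  rmet :> forall p : M, tangent p -> tangent p -> R;
  rmet_metric : fiber_metric (@smooth_vf R n M) rmet
}.

Record levi_civita (R : realType) (n : nat) (M : manifold R n)
    (g : riemannian_metric M) := LeviCivita {
  lc_nabla :> forall p : M, tangent p -> vector_field M -> tangent p;
  lc_metric : metric_connection (@smooth_vf R n M) g lc_nabla;
  lc_torsion_free : forall U p (X Y : vector_field M),
    open U -> U p -> smooth_vf U X -> smooth_vf U Y ->
    lc_nabla (X p) Y - lc_nabla (Y p) X = lie_bracket X Y p
}.

Definition orthonormal (R : realType) (n : nat) (M : manifold R n)
    (g : riemannian_metric M) (p : M) (e : 'I_n -> tangent p) : Prop :=
  forall i j, g p (e i) (e j) = (i == j)%:R.

Definition local_orthonormal_frame (R : realType) (n : nat) (M : manifold R n)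
    (g : riemannian_metric M) (U : set M) (e : 'I_n -> vector_field M) : Prop :=
  (forall i, smooth_vf U (e i)) /\
  (forall p, U p -> orthonormal g (fun i => e i p)).

(* Some local orthonormal frame around p; one exists by the Gram-Schmidt
   process. *)
Definition orthonormal_frame_at (R : realType) (n : nat) (M : manifold R n)
    (g : riemannian_metric M) (p : M) : 'I_n -> vector_field M :=
  xget (fun _ _ => 0)
    [set e | exists U, [/\ open U, U p & local_orthonormal_frame g U e]].

(** * Clifford bundle and Dirac bundles *)

(* [A] is the Clifford algebra of (V, b), with the convention v * v = - b(v, v),
   characterized by its universal property. *)
Definition clifford_algebra (R : realType) (V : lmodType R) (b : V -> V -> R)
    (A : algType R) (iota : {linear V -> A}) : Prop :=
  (forall v, iota v * iota v = (- b v v)%:A) /\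
  (forall (B : algType R) (f : {linear V -> B}),
     (forall v, f v * f v = (- b v v)%:A) ->
     exists F : {lrmorphism A -> B},
       (forall v, F (iota v) = f v) /\
       (forall F' : {lrmorphism A -> B},
          (forall v, F' (iota v) = f v) -> F' =1 F)).

(* The smooth structure, the metric and the connection of Cl(M) are determined by
   the fields from [cl_iota_smooth] on: the monomials e_I in a local orthonormal
   frame are smooth and orthonormal, and the connection is the derivation
   extending the Levi-Civita connection. *)
Record clifford_bundle (R : realType) (n : nat) (M : manifold R n)
    (g : riemannian_metric M) (lc : levi_civita g) := CliffordBundle {
  cl_fiber :> M -> algType R;
  cl_iota : forall p, {linear tangent p -> cl_fiber p};
  cl_clifford : forall p, clifford_algebra (g p) (cl_iota p);
  cl_frames : set (local_frame (fun p => cl_fiber p : lmodType R));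
  cl_atlas : bundle_atlas cl_frames;
  cl_metric : forall p, cl_fiber p -> cl_fiber p -> R;
  cl_nabla : forall p, tangent p -> (forall q, cl_fiber q) -> cl_fiber p;
  cl_iota_smooth : forall U X, open U -> smooth_vf U X ->
    smooth_section cl_frames U (fun p => cl_iota p (X p));
  cl_one_smooth : smooth_section cl_frames setT (fun p => 1 : cl_fiber p);
  cl_mul_smooth : forall U a b, open U ->
    smooth_section cl_frames U a -> smooth_section cl_frames U b ->
    smooth_section cl_frames U (fun p => a p * b p);
  cl_fiber_metric : fiber_metric (smooth_section cl_frames) cl_metric;
  cl_metric_orthonormal : forall p (e : 'I_n -> tangent p), orthonormal g e ->
    forall I J : {set 'I_n},
      cl_metric (\prod_(i < n | i \in I) cl_iota p (e i))
                (\prod_(i < n | i \in J) cl_iota p (e i)) = (I == J)%:R;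
  cl_connection : metric_connection (smooth_section cl_frames) cl_metric cl_nabla;
  cl_nabla_iota : forall U p (v : tangent p) X, open U -> U p -> smooth_vf U X ->
    cl_nabla v (fun q => cl_iota q (X q)) = cl_iota p (lc p v X);
  cl_nabla_mul : forall U p (v : tangent p) a b, open U -> U p ->
    smooth_section cl_frames U a -> smooth_section cl_frames U b ->
    cl_nabla v (fun q => a q * b q) = cl_nabla v a * b p + a p * cl_nabla v b
}.

Arguments cl_frames {R n M g lc} c.
Arguments cl_iota {R n M g lc} c p.

Record left_module (R : realType) (A : algType R) (V : lmodType R)
    (act : A -> V -> V) : Prop := LeftModule {
  act_linearl : forall v, linear (fun a => act a v);
  act_linearr : forall a, linear (act a);
  act_one : forall v, act 1 v = v;
  act_mul : forall a b v, act (a * b) v = act a (act b v)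
}.

Record dirac_bundle (R : realType) (n : nat) (M : manifold R n)
    (g : riemannian_metric M) (lc : levi_civita g) (Cl : clifford_bundle lc) :=
    DiracBundle {
  db_fiber :> M -> lmodType R;
  db_frames : set (local_frame db_fiber);
  db_atlas : bundle_atlas db_frames;
  db_act : forall p, Cl p -> db_fiber p -> db_fiber p;
  db_module : forall p, left_module (@db_act p);
  db_act_smooth : forall U a s, open U ->
    smooth_section (cl_frames Cl) U a -> smooth_section db_frames U s ->
    smooth_section db_frames U (fun p => db_act (a p) (s p));
  db_metric : forall p, db_fiber p -> db_fiber p -> R;
  db_fiber_metric : fiber_metric (smooth_section db_frames) db_metric;
  db_nabla : forall p, tangent p -> (forall q, db_fiber q) -> db_fiber p;
  db_connection : metric_connection (smooth_section db_frames) db_metric db_nabla;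
  db_skew : forall p (v : tangent p) (s t : db_fiber p),
    db_metric (db_act (cl_iota Cl p v) s) t +
    db_metric s (db_act (cl_iota Cl p v) t) = 0;
  db_nabla_act : forall U p (v : tangent p) a s, open U -> U p ->
    smooth_section (cl_frames Cl) U a -> smooth_section db_frames U s ->
    db_nabla v (fun q => db_act (a q) (s q)) =
    db_act (cl_nabla v a) (s p) + db_act (a p) (db_nabla v s)
}.

Arguments db_frames {R n M g lc Cl} d.
Arguments db_nabla {R n M g lc Cl} d p.

Section DiracBundleOperators.

Context (R : realType) (n : nat) (M : manifold R n).
Context (g : riemannian_metric M) (lc : levi_civita g) (Cl : clifford_bundle lc).
Variable S : dirac_bundle Cl.

(* Clifford multiplication by a tangent vector. *)
Definition cmul (p : M) (v : tangent p) (s : S p) : S p :=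
  db_act (cl_iota Cl p v) s.

Definition dirac_operator (sigma : forall p, S p) : forall p, S p := fun p =>
  let e := orthonormal_frame_at g p in
  \sum_(i < n) cmul (e i p) (db_nabla S p (e i p) sigma).

Definition weitzenbock_operator (sigma : forall p, S p) : forall p, S p :=
  fun p =>
  let e := orthonormal_frame_at g p in
  \sum_(i < n) \sum_(j < n | (i < j)%N)
    cmul (e i p) (cmul (e j p) (curvature (db_nabla S)
                                  (e i) (e j) sigma p)).

Definition killing_section (lambda : R) (sigma : forall p, S p) : Prop :=
  forall p (v : tangent p), db_nabla S p v sigma = lambda *: cmul v (sigma p).

End DiracBundleOperators.

(* Main.v *)
(** Killing sections satisfy (ii) by a direct computation.  Conversely, let [f = |sigma|^2].  The
    Weitzenboeck formula [D^2 = - tr (nabla^2) + R] and (ii) give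
    [Laplacian f = 2 * sum_i |nabla_{e_i} sigma - lambda e_i . sigma|^2 >= 0].  A subharmonic function
    on a compact manifold is locally constant by Hopf's strong maximum principle, so the right-hand
    side vanishes.  The maximum principle replaces the usual integration over [M]; it is applied at a
    maximum point of [f] on the closed set of points near which [f] is not constant, which avoids
    connected components. *)

From HB Require Import structures.
From mathcomp Require Import all_boot all_order all_algebra.
From mathcomp Require Import all_classical all_reals all_analysis.
From mathcomp Require Import ring lra.
Require Import Defs.
Set Implicit Arguments.
Unset Strict Implicit.
Unset Printing Implicit Defensive.
Import Order.TTheory GRing.Theory Num.Theory.
Import numFieldNormedType.Exports.
Local Open Scope classical_set_scope.
Local Open Scope ring_scope.

(** * Calculus on R^n *)

Section Differentiation.
Context {R : realType}.

(** Pointwise data are given in choices made separately at each point: [dirac_operator] at [p] uses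
    [orthonormal_frame_at g p], and [tangent p] holds coordinates in [chart_at p]. To differentiate
    [D sigma], or to run Hopf's argument near a point, one smooth frame must serve a whole open set;
    hence Gram-Schmidt on chart domains and the invariance of traces under a change of orthonormal
    frame. The frames do not satisfy [nabla e = 0] at the point; skew-symmetry of the connection
    coefficients takes the place of that normalization. The constants fit because (ii) gives
    [D^2 sigma = n^2 lambda^2 sigma], so the Weitzenböck formula leaves
    [tr (nabla^2) sigma = - n lambda^2 sigma], which is what completes the square. The closed set
    works because, at a maximum point [q] of [f] on it, a nearby value above [f q] would force, by
    the mean value theorem, a point of the set with value above [f q]. So [q] is a local maximum on
    the manifold, Hopf's principle makes [f] constant near [q], and [q] is not in the set. *)

Lemma is_derive_rowP {V : normedModType R} {m} (f : V -> 'rV[R]_m) (x v : V) df :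
  is_derive x v f df <-> forall j, is_derive x v (fun y => f y 0 j) (df 0 j).
Proof.
split=> [[fx <-] j|fx].
  apply: DeriveDef; first by move/derivable_mxP: fx => /(_ 0 j).
  by rewrite derive_mx // mxE.
have fd : derivable f x v.
  by apply/derivable_mxP => i j; rewrite ord1; case: (fx j).
apply: DeriveDef => //; rewrite derive_mx //; apply/rowP => j; rewrite mxE.
by case: (fx j).
Qed.

(** Moves directional derivatives to functions of one real variable, where derivable and
    differentiable agree. *)
Lemma is_derive_lineP {V W : normedModType R} (f : V -> W) (x v : V) df :
  is_derive x v f df <-> is_derive (0 : R) 1 (fun h => f (h *: v + x)) df.
Proof.
have E : 'D_1 (fun h : R => f (h *: v + x)) 0 = 'D_v f x.
  rewrite /derive; set g1 := fun h => h^-1 *: _; set g2 := fun h => h^-1 *: _.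
  suff -> : g1 = g2 by [].
  by rewrite funeqE /g1 /g2 => h /=; rewrite addr0 scale0r add0r [_%:A]mulr1.
split=> -[fx <-]; first by apply: DeriveDef; [exact: (derivable1P f x v).1|].
by apply: DeriveDef; [exact: (derivable1P f x v).2|rewrite E].
Qed.

Lemma is_derive_lineE {V W : normedModType R} (f : V -> W) (x v : V) (t : R) df :
  is_derive (t *: v + x) v f df -> is_derive t 1 (fun h : R => f (h *: v + x)) df.
Proof.
move=> /is_derive_lineP H; apply/is_derive_lineP.
rewrite (_ : (fun h : R => _) = fun h : R => f (h *: v + (t *: v + x))) //.
by apply/funext => h; rewrite [_%:A]mulr1 scalerDl addrA.
Qed.

Lemma mvt_direction {V : normedModType R} (f : V -> R) (x v : V) (h : R) :
  (forall s : R, `|s| <= `|h| -> derivable f (s *: v + x) v) ->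
  exists2 c, `|c| <= `|h| &
    f (h *: v + x) - f x = h * 'D_v f (c *: v + x).
Proof.
move=> fd; pose g (t : R) := f (t *: v + x).
have dg (s : R) : `|s| <= `|h| -> is_derive s (1 : R) g ('D_v f (s *: v + x)).
  by move=> sh; apply: is_derive_lineE; exact: derivableP (fd _ sh).
have cg (a b : R) : (forall s : R, s \in `[a, b] -> `|s| <= `|h|) ->
    {within `[a, b], continuous g}.
  move=> ab; apply: derivable_within_continuous => s sab.
  by case: (dg s (ab _ sab)).
have g0 : g 0 = f x by rewrite /g scale0r add0r.
rewrite -/(g h) -g0.
have [h0|h0] := leP 0 h.
  have ab s : s \in `[0, h] -> `|s| <= `|h|.
    by rewrite in_itv /= => /andP[s0 sh]; rewrite !ger0_norm.
  have [||c cab ->] := @MVT_segment R g (fun s => 'D_v f (s *: v + x)) 0 h h0.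
  - by move=> s sab; apply/dg/ab; exact: subset_itv_oo_cc sab.
  - exact: cg.
  by exists c; [exact: ab|rewrite subr0 mulrC].
have ab s : s \in `[h, 0] -> `|s| <= `|h|.
  by rewrite in_itv /= => /andP[sh s0]; rewrite !ler0_norm ?lerN2// ltW.
have [||c cab E] := @MVT_segment R g (fun s => 'D_v f (s *: v + x)) h 0 (ltW h0).
- by move=> s sab; apply/dg/ab; exact: subset_itv_oo_cc sab.
- exact: cg.
exists c; first exact: ab.
by rewrite -opprB E sub0r mulrN opprK mulrC.
Qed.

Lemma coord_le_norm {n} (x : 'rV[R]_n) j : `|x 0 j| <= `|x|.
Proof.
rewrite [leRHS]/Num.Def.normr/= mx_normrE.
exact: (le_bigmax _ (fun i : 'I_1 * 'I_n => `|x i.1 i.2|) (0, j)).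
Qed.

Lemma norm_le_coord {n} (x : 'rV[R]_n) (r : R) : 0 <= r ->
  (forall j, `|x 0 j| <= r) -> `|x| <= r.
Proof.
move=> r0 xr; rewrite [leLHS]/Num.Def.normr/= mx_normrE.
by apply: bigmax_le => // -[i j] _; rewrite ord1.
Qed.

(* Going from [x] to [x + h] one coordinate at a time, the mean value theorem applies to each step. *)
Lemma C1_differentiable {n} (U : set 'rV[R]_n) (f : 'rV[R]_n -> R) x :
  open U -> U x ->
  (forall y j, U y -> derivable f y (delta_mx 0 j)) ->
  (forall j, {for x, continuous (fun y => 'D_(delta_mx 0 j) f y)}) ->
  differentiable f x.
Proof.
move=> oU Ux fd fc.
pose D j := 'D_(delta_mx 0 j) f x.
pose dfun (h : 'rV[R]_n) : R := \sum_j h 0 j * D j.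
have dlin : linear dfun.
  move=> a u w; rewrite /dfun scaler_sumr -big_split /=; apply: eq_bigr => j _.
  by rewrite !mxE mulrDl [_ *: _]mulrA.
pose L := GRing.isLinear.Build R 'rV[R]_n R *:%R dfun dlin.
pose df : {linear 'rV[R]_n -> R} := HB.pack dfun L.
have dfc : continuous df.
  apply: bounded_linear_continuous; apply/linear_boundedP.
  near=> M => y; rewrite /= /dfun.
  apply: le_trans (ler_norm_sum _ _ _) _.
  apply: (@le_trans _ _ (\sum_j `|D j| * `|y|)).
    apply: ler_sum => j _; rewrite normrM mulrC ler_wpM2l// coord_le_norm //.
  rewrite -mulr_suml ler_wpM2r//; near: M; apply: nbhs_pinfty_ge.
have fo : (f \o shift x : _ -> (R : normedModType R)) =
    cst (f x) + (df : _ -> (R : normedModType R)) +o_ (0 : (_ : normedModType R)) id.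
  apply/eqaddoP => _/posnumP[e].
  (* Each of the [n] coordinate steps may contribute an error [e' * |h|]; the [+ 1] keeps the
     denominator positive when [n = 0]. *)
  pose e' := e%:num / (n%:R + 1).
  have e'0 : 0 < e' by rewrite divr_gt0// ltr_wpDl.
  have /nbhs_ballP[r /= r0 rP] : \forall y \near x, U y /\
      forall j, `|D j - 'D_(delta_mx 0 j) f y| <= e'.
    near=> y; split; first by near: y; exact: open_nbhs_nbhs.
    near: y; apply: filter_forall => j.
    by move/cvgrPdist_le: (fc j) => /(_ _ e'0).
  apply/nbhs_ballP; exists r => //= h; rewrite -ball_normE /= sub0r normrN => hr.
  (* [z k] is [x] moved by the first [k] coordinates of [h]: consecutive points differ along one
     axis, with [z 0 = x] and [z n = h + x]. *)
  pose z k : 'rV[R]_n := \row_j (if (j < k)%N then h 0 j else 0) + x.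
  have zS (k : 'I_n) : z k.+1 = h 0 k *: delta_mx 0 k + z k.
    apply/rowP => j; rewrite !mxE /= addrA; congr (_ + _).
    have [->|jk] := eqVneq j k; first by rewrite ltnSn ltnn mulr1 addr0.
    by rewrite ltnS leq_eqVlt (negbTE (jk : (j != k :> nat))) /= mulr0 add0r.
  have zball (k : 'I_n) (s : R) : `|s| <= `|h 0 k| -> ball x r (s *: delta_mx 0 k + z k).
    move=> sh; rewrite -ball_normE /= distrC; apply: le_lt_trans hr.
    apply: norm_le_coord => // j; rewrite !mxE /=.
    have [->|jk] := eqVneq j k.
      rewrite ltnn mulr1 add0r addrK; apply: le_trans sh _; exact: coord_le_norm.
    rewrite mulr0 add0r addrK; case: ifP => _; last by rewrite normr0.
    exact: coord_le_norm.
  have step (k : 'I_n) : `|f (z k.+1) - f (z k) - h 0 k * D k| <= e' * `|h|.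
    rewrite zS; have [s sh|c ch ->] := @mvt_direction _ f (z k) (delta_mx 0 k) (h 0 k).
      by apply: fd; case: (rP _ (zball k s sh)).
    rewrite -mulrBr normrM mulrC ler_pM//; last exact: coord_le_norm.
    by rewrite distrC; case: (rP _ (zball k c ch)) => _; exact.
  have zn : z n = h + x.
    by apply/rowP => j; rewrite !mxE ltn_ord.
  have z0 : z 0%N = x by apply/rowP => j; rewrite !mxE add0r.
  have -> : (f \o shift x - (cst (f x) + df)) h =
      \sum_(k < n) (f (z k.+1) - f (z k) - h 0 k * D k).
    rewrite sumrB -(big_mkord xpredT (fun k => f (z k.+1) - f (z k))) telescope_sumr//.
    by rewrite zn z0 /= !fctE opprD addrA.
  apply: le_trans (ler_norm_sum _ _ _) _.
  apply: le_trans (ler_sum _ (fun k _ => step k)) _.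
  rewrite sumr_const card_ord -mulr_natl mulrA ler_wpM2r//= /e' mulrCA -[leRHS]mulr1.
  by rewrite ler_pM2l// ler_pdivrMr ?ltr_wpDl// mul1r lerDl.
by apply/diff_locallyP; rewrite (diff_unique dfc fo).
Unshelve. all: by end_near. Qed.

End Differentiation.

Lemma near_open {T : topologicalType} (U : set T) (x : T) (P : T -> Prop) :
  open U -> U x -> (forall y, U y -> P y) -> \forall y \near x, P y.
Proof. by move=> oU Ux UP; apply: filterS UP _; exact: open_nbhs_nbhs. Qed.

Lemma near_eq_continuous_at {T W : topologicalType} (f g : T -> W) (x : T) :
  (\forall y \near x, f y = g y) -> {for x, continuous f} -> {for x, continuous g}.
Proof.
move=> fg; rewrite /prop_for /continuous_at (nbhs_singleton fg); apply: cvg_trans.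
by apply: near_eq_cvg; apply: filterS fg => y ->.
Qed.

(** * Functions of class C^k on open subsets of R^n *)

Section SmoothCalculus.
Context {R : realType}.

Lemma derivable_continuous_line {V W : normedModType R} (f : V -> W) (x v : V) (t : R) :
  derivable f (t *: v + x) v -> {for t, continuous (fun h : R => f (h *: v + x))}.
Proof.
move=> /derivableP/is_derive_lineE[+ _].
by move/derivable1_diffP/differentiable_continuous.
Qed.

(** [phi] is only derivable along [v], so it is replaced by the curve [h |-> phi (h *: v + x)],
    which is differentiable as a function of one variable; [f] is differentiable by
    [C1_differentiable], and the chain rule for differentials applies. *)
Lemma is_derive_chain {V : normedModType R} {m} (U : set 'rV[R]_m)
    (f : 'rV[R]_m -> R) (phi : V -> 'rV[R]_m) (x v : V) dphi :
  open U -> U (phi x) -> class_C 1 U f -> is_derive x v phi dphi ->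
  is_derive x v (fun y => f (phi y))
    (\sum_j dphi 0 j * 'D_(delta_mx 0 j) f (phi x)).
Proof.
move=> oU Ux [_ fC] dp.
have df : differentiable f (phi x).
  apply: (C1_differentiable oU Ux) => [y j Uy|j]; first by case: (fC j) => + _; apply.
  by case: (fC j) => _ [+ _]; apply.
apply/is_derive_lineP.
pose gam (h : R) := phi (h *: v + x).
have [dg Eg] : is_derive (0 : R) 1 gam dphi := (is_derive_lineP phi x v dphi).1 dp.
have g0 : gam 0 = phi x by rewrite /gam scale0r add0r.
have dg' : differentiable gam 0 by apply/derivable1_diffP.
have df' : differentiable f (gam 0) by rewrite g0.
have dfg : differentiable (f \o gam) 0 by exact: differentiable_comp.
apply: DeriveDef; first exact/derivable1_diffP.
rewrite -[fun h : R => _]/(f \o gam) deriveE // diff_comp //= -(deriveE _ dg') Eg g0.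
rewrite {1}(row_sum_delta dphi) linear_sum /=; apply: eq_bigr => j _.
by rewrite linearZ /= -deriveE.
Qed.

Lemma class_C_continuous {n} {V : normedModType R} k U (f : 'rV[R]_n -> V) x :
  class_C k U f -> U x -> {for x, continuous f}.
Proof. by case: k => [|k] [fc _] Ux; exact: fc. Qed.

Lemma class_C_subset {n} {V : normedModType R} k (U U' : set 'rV[R]_n) (f : 'rV[R]_n -> V) :
  U' `<=` U -> class_C k U f -> class_C k U' f.
Proof.
move=> UU; elim: k f => [|k IH] f /= [fc fd]; split => //; try by move=> x /UU/fc.
move=> i; have [fdi fci] := fd i; split; last exact: IH.
by move=> x /UU/fdi.
Qed.

Lemma class_C_congr {n} {V : normedModType R} k (U : set 'rV[R]_n) (f g : 'rV[R]_n -> V) :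
  open U -> (forall x, U x -> f x = g x) -> class_C k U f -> class_C k U g.
Proof.
move=> oU; elim: k f g => [|k IH] f g fg /= [fc fd].
  split=> // x Ux; have := fc _ Ux; apply: near_eq_continuous_at.
  exact: near_open oU Ux fg.
split.
  move=> x Ux; have := fc _ Ux; apply: near_eq_continuous_at.
  exact: near_open oU Ux fg.
move=> i; have [fdi fci] := fd i; split.
  move=> x Ux; apply: near_eq_derivable (fdi _ Ux).
  exact: near_open oU Ux fg.
apply: IH fci => x Ux; apply: near_eq_derive.
exact: near_open oU Ux fg.
Qed.

Lemma class_CW {n} {V : normedModType R} k (U : set 'rV[R]_n) (f : 'rV[R]_n -> V) :
  class_C k.+1 U f -> class_C k U f.
Proof.
elim: k f => [|k IH] f [fc fd]; split=> // i.
by have [fdi fci] := fd i; split=> //; exact: IH.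
Qed.

Lemma class_C_cst {n} {V : normedModType R} k (U : set 'rV[R]_n) (a : V) :
  class_C k U (fun=> a : V).
Proof.
elim: k a => [|k IH] a; split=> //; try by move=> x _; exact: cst_continuous.
move=> i; split=> [x _|]; first exact: derivable_cst.
have -> : (fun x => 'D_(delta_mx 0 i) (fun=> a) x) = fun _ : 'rV[R]_n => 0 : V.
  by apply/funext => x; exact: derive_cst.
exact: IH.
Qed.

Lemma class_CD {n} k (U : set 'rV[R]_n) (f g : 'rV[R]_n -> R) : open U ->
  class_C k U f -> class_C k U g -> class_C k U (fun x => f x + g x).
Proof.
move=> oU; elim: k f g => [|k IH] f g /= [fc fd] [gc gd].
  by split=> // x Ux; exact: cvgD (fc _ Ux) (gc _ Ux).
split=> [x Ux|i]; first by exact: cvgD (fc _ Ux) (gc _ Ux).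
have [fdi fci] := fd i; have [gdi gci] := gd i; split.
  by move=> x Ux; exact: derivableD (fdi _ Ux) (gdi _ Ux).
apply: class_C_congr (IH _ _ fci gci) => // x Ux.
by rewrite -deriveD //; [exact: fdi|exact: gdi].
Qed.

Lemma class_CM {n} k (U : set 'rV[R]_n) (f g : 'rV[R]_n -> R) : open U ->
  class_C k U f -> class_C k U g -> class_C k U (fun x => f x * g x).
Proof.
move=> oU; elim: k f g => [|k IH] f g fC gC.
  case: fC gC => fc fd [gc gd].
  by split=> // x Ux; exact: cvgM (fc _ Ux) (gc _ Ux).
have [fc fd] := fC; have [gc gd] := gC.
split=> [x Ux|i]; first by exact: cvgM (fc _ Ux) (gc _ Ux).
have [fdi fci] := fd i; have [gdi gci] := gd i; split.
  by move=> x Ux; exact: derivableM (fdi _ Ux) (gdi _ Ux).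
apply: class_C_congr (class_CD oU (IH _ _ (class_CW fC) gci) (IH _ _ (class_CW gC) fci)) => //.
by move=> x Ux; rewrite -[RHS]/('D_(delta_mx 0 i) (f * g) x) deriveM //; [exact: fdi|exact: gdi].
Qed.

Lemma class_C_sum {n} k (U : set 'rV[R]_n) I (r : seq I) (f : I -> 'rV[R]_n -> R) :
  open U -> (forall i, class_C k U (f i)) ->
  class_C k U (fun x => \sum_(i <- r) f i x).
Proof.
move=> oU fC; elim: r => [|i r IH].
  apply: class_C_congr (class_C_cst k U (0 : R)) => // x _.
  by rewrite big_nil.
by apply: class_C_congr (class_CD oU (fC i) IH) => // x _; rewrite big_cons.
Qed.

Lemma continuous_rowP {T : topologicalType} {m} (f : T -> 'rV[R]_m) (x : T) :
  {for x, continuous f} <-> forall j, {for x, continuous (fun y => f y 0 j)}.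
Proof.
split=> [fc j|fc].
  apply: (@continuous_comp _ _ _ f (fun y : 'rV[R]_m => y 0 j)) => //.
  exact: coord_continuous.
apply/cvgrPdist_le => /= e e0.
have /= H : \forall y \near x, forall j, `|f x 0 j - f y 0 j| <= e.
  apply: filter_forall => j.
  by move/cvgrPdist_le : (fc j) => /(_ _ e0).
near=> y; apply: norm_le_coord; first exact: ltW.
by move=> j; rewrite !mxE; move: j; near: y.
Unshelve. all: by end_near. Qed.

Lemma class_C_rowP {n m} k (U : set 'rV[R]_n) (f : 'rV[R]_n -> 'rV[R]_m) : open U ->
  class_C k U f <-> forall j, class_C k U (fun x => f x 0 j).
Proof.
move=> oU; elim: k f => [|k IH] f; split.
- by move=> [fc _] j; split=> // x Ux; move/continuous_rowP: (fc _ Ux).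
- by move=> fC; split=> // x Ux; apply/continuous_rowP => j; case: (fC j) => + _; apply.
- move=> [fc fd] j; split=> [x Ux|i]; first by move/continuous_rowP: (fc _ Ux).
  have [fdi /IH fci] := fd i; split=> [x Ux|].
    by move/derivable_mxP: (fdi _ Ux) => /(_ 0 j).
  apply: class_C_congr (fci j) => // x Ux.
  by rewrite derive_mx ?mxE //; exact: fdi.
- move=> fC; have fdi i x : U x -> derivable f x (delta_mx 0 i).
    move=> Ux; apply/derivable_mxP => i' j; rewrite ord1.
    by case: (fC j) => _ /(_ i)[+ _]; apply.
  split=> [x Ux|i].
    by apply/continuous_rowP => j; case: (fC j) => + _; apply.
  split=> [x Ux|]; first exact: fdi.
  apply/IH => j; case: (fC j) => _ /(_ i)[_ +]; apply: class_C_congr => // x Ux.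
  by rewrite derive_mx ?mxE //; exact: fdi.
Qed.

Lemma class_C_is_derive {n} k (U : set 'rV[R]_n) (f : 'rV[R]_n -> R) x (v : 'rV[R]_n) :
  open U -> U x -> class_C k.+1 U f ->
  is_derive x v f (\sum_j v 0 j * 'D_(delta_mx 0 j) f x).
Proof.
move=> oU Ux fC.
have {}fC : class_C 1 U f by elim: k fC => [//|k IH] /class_CW.
have := is_derive_chain oU Ux fC (is_derive_id x v); exact.
Qed.

Lemma class_C_is_derive_row {n m} k (U : set 'rV[R]_n) (f : 'rV[R]_n -> 'rV[R]_m) x
    (v : 'rV[R]_n) :
  open U -> U x -> class_C k.+1 U f ->
  is_derive x v f (\sum_j v 0 j *: 'D_(delta_mx 0 j) f x).
Proof.
move=> oU Ux fC; apply/is_derive_rowP => j.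
have fCj := (class_C_rowP _ _ oU).1 fC j.
apply: is_derive_eq; first exact: (class_C_is_derive v oU Ux fCj).
rewrite summxE; apply: eq_bigr => i _; rewrite mxE derive_mx ?mxE //.
by case: fC => _ /(_ i)[+ _]; apply.
Qed.

(** By the chain rule the partial derivatives of the composite are sums of products of
    [phi]-derivatives with composites of lower order, so induction on [k] closes. *)
Lemma class_C_comp {n m} k (U : set 'rV[R]_n) (U' : set 'rV[R]_m)
    (f : 'rV[R]_m -> R) (phi : 'rV[R]_n -> 'rV[R]_m) :
  open U -> open U' -> (forall x, U x -> U' (phi x)) ->
  class_C k U' f -> class_C k U phi -> class_C k U (fun x => f (phi x)).
Proof.
move=> oU oU' UU'; elim: k f => [|k IH] f fC pC.
  split=> // x Ux; apply: continuous_comp; first exact: class_C_continuous pC Ux.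
  exact: class_C_continuous fC (UU' _ Ux).
split=> [x Ux|i].
  apply: continuous_comp; first exact: class_C_continuous pC Ux.
  exact: class_C_continuous fC (UU' _ Ux).
have fC1 : class_C 1 U' f by elim: (k) fC => [//|l IHl] /class_CW.
have pd x : U x -> is_derive x (delta_mx 0 i) phi ('D_(delta_mx 0 i) phi x).
  by move=> Ux; apply: derivableP; case: pC => _ /(_ i)[+ _]; apply.
have fd x : U x -> is_derive x (delta_mx 0 i) (fun x => f (phi x))
    (\sum_j 'D_(delta_mx 0 i) phi x 0 j * 'D_(delta_mx 0 j) f (phi x)).
  by move=> Ux; exact: is_derive_chain oU' (UU' _ Ux) fC1 (pd _ Ux).
split=> [x /fd[]//|].
apply: (class_C_congr oU (f := fun x =>
    \sum_j 'D_(delta_mx 0 i) phi x 0 j * 'D_(delta_mx 0 j) f (phi x))).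
  by move=> x /fd[].
apply: class_C_sum => // j; apply: class_CM => //.
  have pCi : class_C k U ('D_(delta_mx 0 i) phi) by case: pC => _ /(_ i)[].
  exact: (class_C_rowP _ _ oU).1 pCi j.
have fCj : class_C k U' ('D_(delta_mx 0 j) f) by case: fC => _ /(_ j)[].
exact: (IH _ fCj (class_CW pC)).
Qed.

(** With [r = f^(-1/2)], each partial derivative is [- r^3 / 2] times that of [f]: a polynomial in
    [r] itself, so the induction on [k] feeds on its own conclusion. This is what normalizing a
    vector field requires. *)
Lemma class_C_invsqrt {n} k (U : set 'rV[R]_n) (f : 'rV[R]_n -> R) : open U ->
  (forall x, U x -> 0 < f x) -> class_C k U f ->
  class_C k U (fun x => (Num.sqrt (f x))^-1).
Proof.
move=> oU f0.
have sc x : U x -> {for x, continuous f} -> {for x, continuous (fun x => (Num.sqrt (f x))^-1)}.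
  move=> Ux fc; have s0 : Num.sqrt (f x) != 0 by rewrite gt_eqF// sqrtr_gt0 f0.
  apply: (@continuousV _ _ (fun x => Num.sqrt (f x)) x s0).
  exact: (continuous_comp fc (@sqrt_continuous _ _)).
elim: k => [|k IH] fC.
  by split=> // x Ux; apply: sc => //; exact: class_C_continuous fC Ux.
split=> [x Ux|i]; first by apply: sc => //; exact: class_C_continuous fC Ux.
pose r x := (Num.sqrt (f x))^-1.
have rd x : U x -> is_derive x (delta_mx 0 i) r
    (- 2^-1 * (r x * r x * r x) * 'D_(delta_mx 0 i) f x).
  move=> Ux; have f0x := f0 _ Ux.
  have /is_derive_lineP df : is_derive x (delta_mx 0 i) f ('D_(delta_mx 0 i) f x).
    by apply: derivableP; case: fC => _ /(_ i)[+ _]; apply.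
  apply/is_derive_lineP.
  have s0 : Num.sqrt (f x) != 0 by rewrite gt_eqF// sqrtr_gt0.
  have ds : is_derive (0 : R) 1 (Num.sqrt \o fun h : R => f (h *: delta_mx 0 i + x))
      ((2 * Num.sqrt (f x))^-1 * 'D_(delta_mx 0 i) f x).
    have := @is_derive1_comp _ Num.sqrt (fun h : R => f (h *: delta_mx 0 i + x)) 0.
    rewrite scale0r add0r; apply => //; exact: is_derive1_sqrt.
  apply: is_derive_eq; first apply: is_deriveV.
    by rewrite /= scale0r add0r.
  rewrite /= scale0r add0r /r -[LHS]/(_ * _); field.
  exact: s0.
split=> [x /rd[]//|].
have rC := IH (class_CW fC).
apply: (class_C_congr oU (f := fun x =>
    - 2^-1 * (r x * r x * r x) * 'D_(delta_mx 0 i) f x)).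
  by move=> x /rd[].
apply: class_CM => //; last by case: fC => _ /(_ i)[].
apply: class_CM => //; first exact: class_C_cst.
by apply: class_CM => //; exact: class_CM.
Qed.

End SmoothCalculus.

(** * Smooth functions and vector fields on manifolds *)

Section ManifoldCalculus.
Context {R : realType} {n : nat} (M : manifold R n).
Implicit Types (U : set M) (p q : M) (c : chart R n M).

Lemma atlas_chart_at p : atlas (chart_at p).
Proof. by rewrite /chart_at; case: cid => c []. Qed.

Lemma cdom_chart_at p : cdom (chart_at p) p.
Proof. by rewrite /chart_at; case: cid => c []. Qed.

Lemma near_cimg c U p : open U -> U p -> cdom c p ->
  \forall x \near cmap c p, exists q, [/\ U q, cdom c q & x = cmap c q].
Proof.
move=> oU Up cp.
have : \forall x \near cmap c p, (cmap c @` cdom c) x.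
  by apply: open_nbhs_nbhs; split; [exact: cimg_open|exists p].
have : \forall x \near cmap c p, U (cinv c x).
  have := cinv_continuous cp; rewrite /prop_for /continuous_at cmapK // => /(_ U).
  by apply; exact: open_nbhs_nbhs.
by apply: filterS2 => x Ux [q cq qx]; exists q; split=> //; rewrite -(cmapK cq) qx.
Qed.

Lemma open_cimg c U : open U -> open (cmap c @` (U `&` cdom c)).
Proof.
move=> oU; rewrite openE => _ [p [Up cp] <-].
by apply: filterS (near_cimg oU Up cp) => x [q [Uq cq ->]]; exists q.
Qed.

Arguments open_cimg c {U} _.

Lemma smooth_fun_subset (V : normedModType R) U U' (f : M -> V) :
  U' `<=` U -> smooth_fun U f -> smooth_fun U' f.
Proof.
move=> UU fs c ac k; apply: class_C_subset (fs c ac k).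
by move=> _ [q [/UU Uq cq] <-]; exists q.
Qed.

Lemma smooth_fun_congr (V : normedModType R) U (f g : M -> V) :
  open U -> (forall q, U q -> f q = g q) -> smooth_fun U f -> smooth_fun U g.
Proof.
move=> oU fg fs c ac k; apply: class_C_congr (fs c ac k); first exact: open_cimg.
by move=> _ [q [/fg fgq cq] <-] /=; rewrite cmapK.
Qed.

Lemma smooth_fun_cst (V : normedModType R) U (a : V) : smooth_fun U (fun=> a).
Proof. by move=> c ac k; exact: class_C_cst. Qed.

Arguments smooth_fun_cst {V} U a.

Lemma smooth_funD U (f g : M -> R) : open U ->
  smooth_fun U f -> smooth_fun U g -> smooth_fun U (fun q => f q + g q).
Proof.
move=> oU fs gs c ac k.
exact: (class_CD (open_cimg c oU) (fs c ac k) (gs c ac k)).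
Qed.

Lemma smooth_funM U (f g : M -> R) : open U ->
  smooth_fun U f -> smooth_fun U g -> smooth_fun U (fun q => f q * g q).
Proof.
move=> oU fs gs c ac k.
exact: (class_CM (open_cimg c oU) (fs c ac k) (gs c ac k)).
Qed.

Lemma smooth_funN U (f : M -> R) : open U ->
  smooth_fun U f -> smooth_fun U (fun q => - f q).
Proof.
move=> oU fs; apply: smooth_fun_congr (smooth_funM oU (smooth_fun_cst U (-1 : R)) fs) => //.
by move=> q _; rewrite mulN1r.
Qed.

Lemma smooth_funX U (f : M -> R) m : open U ->
  smooth_fun U f -> smooth_fun U (fun q => f q ^+ m).
Proof.
move=> oU fs; elim: m => [|m IH]; first exact: smooth_fun_cst.
by apply: smooth_fun_congr (smooth_funM oU fs IH) => // q _; rewrite exprS.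
Qed.

Arguments smooth_funX {U f} m _ _.

Lemma smooth_fun_sum U I (r : seq I) (f : I -> M -> R) : open U ->
  (forall i, smooth_fun U (f i)) -> smooth_fun U (fun q => \sum_(i <- r) f i q).
Proof.
move=> oU fs c ac k.
by apply: (class_C_sum _ (open_cimg c oU)) => i; exact: fs.
Qed.

Lemma smooth_fun_invsqrt U (f : M -> R) : open U -> (forall q, U q -> 0 < f q) ->
  smooth_fun U f -> smooth_fun U (fun q => (Num.sqrt (f q))^-1).
Proof.
move=> oU f0 fs c ac k.
apply: (class_C_invsqrt (open_cimg c oU) _ (fs c ac k)).
by move=> _ [q [Uq cq] <-] /=; rewrite cmapK // f0.
Qed.

Lemma smooth_fun_rowP {m} U (f : M -> 'rV[R]_m) : open U ->
  smooth_fun U f <-> forall j, smooth_fun U (fun q => f q 0 j).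
Proof.
move=> oU; split=> [fs j c ac k|fs c ac k].
  exact: (class_C_rowP _ _ (open_cimg c oU)).1 (fs c ac k) j.
by apply/(class_C_rowP _ _ (open_cimg c oU)) => j; exact: fs.
Qed.

Lemma smooth_fun_continuous (V : normedModType R) U (f : M -> V) c p :
  smooth_fun U f -> atlas c -> U p -> cdom c p ->
  {for cmap c p, continuous (f \o cinv c)}.
Proof.
move=> fs ac Up cp; apply: class_C_continuous (fs c ac 0) _.
by exists p.
Qed.

Lemma smooth_cmap c j : atlas c -> smooth_fun (cdom c) (fun q => cmap c q 0 j).
Proof.
move=> ac; apply/(smooth_fun_rowP _ (@cdom_open _ _ _ c)).1 => c' ac' k.
by rewrite setIC; exact: atlas_compat.
Qed.

Arguments smooth_cmap {c} j _.

Lemma near_chart_eq (V : Type) U (f g : M -> V) c p : open U -> U p -> cdom c p ->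
  (forall q, U q -> f q = g q) ->
  \forall x \near cmap c p, (f \o cinv c) x = (g \o cinv c) x.
Proof.
move=> oU Up cp fg; apply: filterS (near_cimg oU Up cp) => x [q [Uq cq ->]] /=.
by rewrite cmapK // fg.
Qed.

Lemma tderive_congr (V : normedModType R) U (f g : M -> V) p (v : tangent p) :
  open U -> U p -> (forall q, U q -> f q = g q) -> tderive v f = tderive v g.
Proof.
move=> oU Up fg; apply: near_eq_derive.
exact: (near_chart_eq oU Up (cdom_chart_at p) fg).
Qed.

Lemma tderiveP U (f : M -> R) p (v : tangent p) :
  open U -> U p -> smooth_fun U f ->
  is_derive (cmap (chart_at p) p) (v : 'rV[R]_n) (f \o cinv (chart_at p)) (tderive v f).
Proof.
move=> oU Up fs; apply: derivableP.
have [] // := class_C_is_derive (x := cmap (chart_at p) p) (v : 'rV[R]_n)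
  (open_cimg (chart_at p) oU) _ (fs _ (atlas_chart_at p) 1).
by exists p; split=> //; exact: cdom_chart_at.
Qed.

Lemma tderiveE U (f : M -> R) p (v : tangent p) :
  open U -> U p -> smooth_fun U f ->
  tderive v f = \sum_j (v : 'rV[R]_n) 0 j *
    'D_(delta_mx 0 j) (f \o cinv (chart_at p)) (cmap (chart_at p) p).
Proof.
move=> oU Up fs.
have [] // := class_C_is_derive (x := cmap (chart_at p) p) (v : 'rV[R]_n)
  (open_cimg (chart_at p) oU) _ (fs _ (atlas_chart_at p) 1).
by exists p; split=> //; exact: cdom_chart_at.
Qed.

Lemma tderive_linear U (f : M -> R) p (a : R) (u v : tangent p) :
  open U -> U p -> smooth_fun U f ->
  tderive (a *: u + v) f = a * tderive u f + tderive v f.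
Proof.
move=> oU Up fs; rewrite !(tderiveE _ oU Up fs) mulr_sumr -big_split /=.
by apply: eq_bigr => j _; rewrite !mxE mulrDl mulrA.
Qed.

Lemma tderive0 U (f : M -> R) p : open U -> U p -> smooth_fun U f ->
  tderive (0 : tangent p) f = 0.
Proof.
move=> oU Up fs; rewrite (tderiveE _ oU Up fs) big1 // => j _.
by rewrite mxE mul0r.
Qed.

Lemma tderive_cst p (v : tangent p) (a : R) : tderive v (fun=> a) = 0.
Proof. exact: derive_cst. Qed.

Lemma tderiveD U (f g : M -> R) p (v : tangent p) : open U -> U p ->
  smooth_fun U f -> smooth_fun U g ->
  tderive v (fun q => f q + g q) = tderive v f + tderive v g.
Proof.
move=> oU Up fs gs.
by have [] := is_deriveD (tderiveP v oU Up fs) (tderiveP v oU Up gs).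
Qed.

Lemma tderiveM U (f g : M -> R) p (v : tangent p) : open U -> U p ->
  smooth_fun U f -> smooth_fun U g ->
  tderive v (fun q => f q * g q) = f p * tderive v g + g p * tderive v f.
Proof.
move=> oU Up fs gs.
have [_ ] := is_deriveM (tderiveP v oU Up fs) (tderiveP v oU Up gs).
by rewrite /= cmapK //; exact: cdom_chart_at.
Qed.

Lemma tderiveN U (f : M -> R) p (v : tangent p) : open U -> U p ->
  smooth_fun U f -> tderive v (fun q => - f q) = - tderive v f.
Proof.
move=> oU Up fs; have := tderiveM v oU Up (smooth_fun_cst U (-1 : R)) fs.
rewrite tderive_cst mulr0 addr0 mulN1r => <-.
by apply: (tderive_congr _ oU Up) => q _; rewrite mulN1r.
Qed.

Lemma tderive_sum U m (f : 'I_m -> M -> R) p (v : tangent p) :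
  open U -> U p -> (forall i, smooth_fun U (f i)) ->
  tderive v (fun q => \sum_i f i q) = \sum_i tderive v (f i).
Proof.
move=> oU Up; elim: m f => [|m IH] f fs.
  rewrite big_ord0 -[RHS](tderive_cst v 0); apply: (tderive_congr _ oU Up) => q _.
  by rewrite big_ord0.
rewrite big_ord_recl -IH => [|i]; last exact: fs.
rewrite -(tderiveD _ oU Up) //; last by apply: smooth_fun_sum => // i; exact: fs.
by apply: (tderive_congr _ oU Up) => q _; rewrite big_ord_recl.
Qed.

Lemma tderiveX U (f : M -> R) m p (v : tangent p) : open U -> U p ->
  smooth_fun U f ->
  tderive v (fun q => f q ^+ m.+1) = m.+1%:R * f p ^+ m * tderive v f.
Proof.
move=> oU Up fs; elim: m => [|m IH]; first by rewrite expr0 !mul1r.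
have E : (fun q => f q ^+ m.+2) = fun q => f q * f q ^+ m.+1.
  by apply/funext => q; rewrite exprS.
rewrite E (tderiveM v oU Up fs (smooth_funX m.+1 oU fs)) IH.
by rewrite exprS -[m.+2]addn1 natrD; ring.
Qed.

Lemma is_derive_transition c c' p (v : 'rV[R]_n) : atlas c -> atlas c' ->
  cdom c p -> cdom c' p ->
  is_derive (cmap c p) v (cmap c' \o cinv c) ('D_v (cmap c' \o cinv c) (cmap c p)).
Proof.
move=> ac ac' cp c'p; apply: derivableP.
have W : (cmap c @` (cdom c' `&` cdom c)) (cmap c p) by exists p.
have C1 : class_C 1 (cmap c @` (cdom c' `&` cdom c)) (cmap c' \o cinv c).
  by rewrite setIC; exact: atlas_compat.
by have [] := class_C_is_derive_row v (open_cimg c (@cdom_open _ _ _ c')) W C1.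
Qed.

(* Chain rule for [f \o cinv c' = (f \o cinv c) \o (cmap c \o cinv c')]. *)
Lemma is_derive_change_chart c c' U (f : M -> R) p (v : 'rV[R]_n) :
  atlas c -> atlas c' -> cdom c p -> cdom c' p ->
  open U -> U p -> smooth_fun U f ->
  is_derive (cmap c' p) v (f \o cinv c')
    (\sum_j ('D_v (cmap c \o cinv c') (cmap c' p)) 0 j *
       'D_(delta_mx 0 j) (f \o cinv c) (cmap c p)).
Proof.
move=> ac ac' cp c'p oU Up fs.
have dp := is_derive_transition v ac' ac c'p cp.
have E : (cmap c \o cinv c') (cmap c' p) = cmap c p by rewrite /= cmapK.
have W : (cmap c @` (U `&` cdom c)) ((cmap c \o cinv c') (cmap c' p)).
  by rewrite E; exists p.
have := is_derive_chain (open_cimg c oU) W (fs c ac 1) dp; rewrite E.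
apply: near_eq_is_derive; apply: filterS (near_cimg (@cdom_open _ _ _ c) cp c'p).
by move=> x [q [cq c'q ->]] /=; rewrite !cmapK // cmapK.
Qed.

(** The preferred chart used by [tderive] may jump from point to point; in one fixed chart the
    dependence on the base point becomes visible. *)
Lemma tderive_chart c U (f : M -> R) p (v : tangent p) :
  atlas c -> cdom c p -> open U -> U p -> smooth_fun U f ->
  tderive v f = \sum_j tcoord c v 0 j * 'D_(delta_mx 0 j) (f \o cinv c) (cmap c p).
Proof.
move=> ac cp oU Up fs.
by have [_] := is_derive_change_chart (v : 'rV[R]_n) ac (atlas_chart_at p) cp
  (cdom_chart_at p) oU Up fs.
Qed.

Lemma tcoordE c p (v : tangent p) j : atlas c -> cdom c p ->
  tcoord c v 0 j = tderive v (fun q => cmap c q 0 j).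
Proof.
move=> ac cp.
have := is_derive_transition (v : 'rV[R]_n) (atlas_chart_at p) ac (cdom_chart_at p) cp.
by move=> /is_derive_rowP /(_ j)[].
Qed.

Lemma tcoord_linear c p (a : R) (u v : tangent p) : atlas c -> cdom c p ->
  tcoord c (a *: u + v) = a *: tcoord c u + tcoord c v.
Proof.
move=> ac cp; apply/rowP => j; rewrite !mxE !tcoordE //.
exact: (tderive_linear _ _ _ (@cdom_open _ _ _ c) cp (smooth_cmap j ac)).
Qed.

Lemma tcoord_chart_at p (v : tangent p) : tcoord (chart_at p) v = v.
Proof.
rewrite -[RHS](derive_id (cmap (chart_at p) p) v); apply: near_eq_derive.
have cp := cdom_chart_at p.
apply: filterS (near_cimg (@cdom_open _ _ _ (chart_at p)) cp cp).
by move=> x [q [_ cq ->]] /=; rewrite cmapK.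
Qed.

Lemma smooth_vf_subset U U' (X : vector_field M) :
  U' `<=` U -> smooth_vf U X -> smooth_vf U' X.
Proof.
by move=> UU Xs c ac; apply: smooth_fun_subset (Xs c ac) => q [/UU].
Qed.

(** Replaces coordinates by derivatives of coordinate functions, so that linearity of [tderive] in
    the vector shows that linear combinations of smooth fields are smooth. *)
Lemma smooth_vfP U (X : vector_field M) : open U ->
  smooth_vf U X <-> forall c j, atlas c ->
    smooth_fun (U `&` cdom c) (fun q => tderive (X q) (fun q => cmap c q 0 j)).
Proof.
move=> oU; have oUc c : open (U `&` cdom c) by apply: openI => //; exact: cdom_open.
split=> [Xs c j ac|Xs c ac].
  apply: smooth_fun_congr ((smooth_fun_rowP _ (oUc c)).1 (Xs c ac) j) => // q [_ cq].
  exact: tcoordE.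
apply/(smooth_fun_rowP _ (oUc c)) => j; apply: smooth_fun_congr (Xs c j ac) => // q [_ cq].
by rewrite tcoordE.
Qed.

Lemma smooth_vfZD U (f : M -> R) (X Y : vector_field M) : open U ->
  smooth_fun U f -> smooth_vf U X -> smooth_vf U Y ->
  smooth_vf U (fun q => f q *: X q + Y q).
Proof.
move=> oU fs /(smooth_vfP _ oU) Xs /(smooth_vfP _ oU) Ys.
apply/(smooth_vfP _ oU) => c j ac.
have oUc : open (U `&` cdom c) by apply: openI => //; exact: cdom_open.
apply: smooth_fun_congr (smooth_funD oUc (smooth_funM oUc _ (Xs c j ac)) (Ys c j ac)) => //.
  move=> q [_ cq].
  by rewrite (tderive_linear _ _ _ (@cdom_open _ _ _ c) cq (smooth_cmap j ac)).
by apply: smooth_fun_subset fs => q [].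
Qed.

Lemma smooth_vf0 U : open U -> smooth_vf U (fun=> 0).
Proof.
move=> oU; apply/(smooth_vfP _ oU) => c j ac.
have oUc : open (U `&` cdom c) by apply: openI => //; exact: cdom_open.
apply: smooth_fun_congr (smooth_fun_cst _ (0 : R)) => // q [_ cq].
by rewrite (tderive0 (@cdom_open _ _ _ c) cq (smooth_cmap j ac)).
Qed.

Lemma smooth_vfZ U (f : M -> R) (X : vector_field M) : open U ->
  smooth_fun U f -> smooth_vf U X -> smooth_vf U (fun q => f q *: X q).
Proof.
move=> oU fs Xs; have := smooth_vfZD oU fs Xs (smooth_vf0 oU).
by congr (smooth_vf _ _); apply/functional_extensionality_dep => q; rewrite addr0.
Qed.

Lemma smooth_vf_sum U I (r : seq I) (f : I -> M -> R) (X : I -> vector_field M) : open U ->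
  (forall i, smooth_fun U (f i)) -> (forall i, smooth_vf U (X i)) ->
  smooth_vf U (fun q => \sum_(i <- r) f i q *: X i q).
Proof.
move=> oU fs Xs; elim: r => [|i r IH].
  have := smooth_vf0 oU; congr (smooth_vf _ _).
  by apply: functional_extensionality_dep => q; rewrite big_nil.
have := smooth_vfZD oU (fs i) (Xs i) IH.
by congr (smooth_vf _ _); apply: functional_extensionality_dep => q; rewrite big_cons.
Qed.

Lemma smooth_fun_tderive U (f : M -> R) (X : vector_field M) : open U ->
  smooth_fun U f -> smooth_vf U X -> smooth_fun U (fun q => tderive (X q) f).
Proof.
move=> oU fs Xs c ac k.
have oW := open_cimg c oU.
apply: (class_C_congr oW (f := fun x => \sum_j (fun x => tcoord c (X (cinv c x)) 0 j) x *
    'D_(delta_mx 0 j) (f \o cinv c) x)).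
  by move=> _ [q [Uq cq] <-] /=; rewrite cmapK // -(tderive_chart _ ac cq oU Uq fs).
apply: class_C_sum => // j; apply: class_CM => //.
  have := Xs c ac c ac k; rewrite -setIA setIid => Xc.
  exact: (class_C_rowP _ _ oW).1 Xc j.
by case: (fs c ac k.+1) => _ /(_ j)[].
Qed.

(* The [j]-th coordinate vector field of the chart [c]; its value at [q] has to be expressed in
   the coordinates of [chart_at q]. *)
Definition coord_vf c (j : 'I_n) : vector_field M :=
  fun q => 'D_(delta_mx 0 j) (cmap (chart_at q) \o cinv c) (cmap c q).

Lemma tcoord_coord_vf c c' j q : atlas c -> atlas c' -> cdom c q -> cdom c' q ->
  tcoord c' (coord_vf c j q) = 'D_(delta_mx 0 j) (cmap c' \o cinv c) (cmap c q).
Proof.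
move=> ac ac' cq c'q; apply/rowP => i; rewrite tcoordE //.
have oc' := @cdom_open _ _ _ c'.
rewrite (tderive_chart _ (atlas_chart_at q) (cdom_chart_at q) oc' c'q (smooth_cmap i ac')).
rewrite tcoord_chart_at.
have [_ <-] := is_derive_change_chart (delta_mx 0 j) (atlas_chart_at q) ac
  (cdom_chart_at q) cq oc' c'q (smooth_cmap i ac').
have := is_derive_transition (delta_mx 0 j) ac ac' cq c'q.
by move=> /is_derive_rowP /(_ i)[].
Qed.

Lemma smooth_coord_vf c j : atlas c -> smooth_vf (cdom c) (coord_vf c j).
Proof.
move=> ac c' ac'.
have oc := @cdom_open _ _ _ c; have oc' := @cdom_open _ _ _ c'.
have occ' : open (cdom c `&` cdom c') by exact: openI.
apply: (smooth_fun_congr (f := fun q => 'D_(delta_mx 0 j) (cmap c' \o cinv c) (cmap c q))) => //.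
  by move=> q [cq c'q]; rewrite tcoord_coord_vf.
apply/smooth_fun_rowP => // i c'' ac'' k.
pose W := cmap c @` (cdom c `&` cdom c').
have oW : open W by rewrite /W setIC; exact: open_cimg.
apply: (class_C_comp (U' := W) (f := fun x => 'D_(delta_mx 0 j) (cmap c' \o cinv c) x 0 i)
  (phi := cmap c \o cinv c'')).
- exact: open_cimg.
- exact: oW.
- by move=> _ [q [[cq c'q] c''q] <-] /=; exists q; rewrite ?cmapK.
- apply: ((class_C_rowP k _ oW).1 _ i).
  by case: (atlas_compat ac ac' k.+1) => _ /(_ j)[].
apply: class_C_subset (atlas_compat ac'' ac k) => _ [q [[cq c'q] c''q] <-].
by exists q.
Qed.

Lemma tcoord_coord_vf_id c j q : atlas c -> cdom c q ->
  tcoord c (coord_vf c j q) = delta_mx 0 j.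
Proof.
move=> ac cq; rewrite tcoord_coord_vf // -[RHS](derive_id (cmap c q)).
apply: near_eq_derive; apply: filterS (near_cimg (@cdom_open _ _ _ c) cq cq).
by move=> x [p [_ cp ->]] /=; rewrite cmapK.
Qed.

End ManifoldCalculus.

Arguments open_cimg {R n M} c {U} _.
Arguments smooth_fun_cst {R n M V} U a.
Arguments smooth_cmap {R n M c} j _.

(** * Fibre metrics and orthonormal frames *)

Lemma addrr_eq0 (V : zmodType) (x : V) : x = x + x -> x = 0.
Proof. by move/eqP; rewrite -subr_eq0 opprD addNKr oppr_eq0 => /eqP. Qed.

Section FiberMetric.
Context {R : realType} {n : nat} {M : manifold R n} {E : M -> lmodType R}.
Context {sm : set M -> (forall p, E p) -> Prop} {h : forall p, E p -> E p -> R}.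
Hypothesis hm : fiber_metric sm h.

Lemma fm_0l p (t : E p) : h 0 t = 0.
Proof.
by have := fm_linear hm 1 0 0 t; rewrite scaler0 addr0 mul1r => /addrr_eq0.
Qed.

Lemma fm_Dl p (s s' t : E p) : h (s + s') t = h s t + h s' t.
Proof. by have := fm_linear hm 1 s s' t; rewrite scale1r mul1r. Qed.

Lemma fm_Zl p a (s t : E p) : h (a *: s) t = a * h s t.
Proof. by have := fm_linear hm a s 0 t; rewrite !addr0 fm_0l addr0. Qed.

Lemma fm_suml p I (r : seq I) (s : I -> E p) (t : E p) :
  h (\sum_(i <- r) s i) t = \sum_(i <- r) h (s i) t.
Proof.
elim: r => [|i r IH]; first by rewrite !big_nil fm_0l.
by rewrite !big_cons fm_Dl IH.
Qed.

Lemma fm_Dr p (s s' t : E p) : h t (s + s') = h t s + h t s'.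
Proof. by rewrite !(fm_sym hm t) fm_Dl. Qed.

Lemma fm_Zr p a (s t : E p) : h t (a *: s) = a * h t s.
Proof. by rewrite !(fm_sym hm t) fm_Zl. Qed.

Lemma fm_sumr p I (r : seq I) (s : I -> E p) (t : E p) :
  h t (\sum_(i <- r) s i) = \sum_(i <- r) h t (s i).
Proof. by rewrite (fm_sym hm) fm_suml; apply: eq_bigr => i _; rewrite (fm_sym hm). Qed.

Lemma fm_eq0 p (s : E p) : h s s <= 0 -> s = 0.
Proof. by have [//|/(fm_pos hm)] := eqVneq s 0; rewrite ltNge => /negbTE ->. Qed.

Lemma fm_ge0 p (s : E p) : 0 <= h s s.
Proof. by have [->|/(fm_pos hm)/ltW //] := eqVneq s 0; rewrite fm_0l. Qed.

End FiberMetric.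

Section Frames.
Context {R : realType} {n : nat} {M : manifold R n} (g : riemannian_metric M).
Let gm : fiber_metric (@smooth_vf R n M) g := rmet_metric g.

(** Orthonormality makes the [n] rows of [Em] independent, and [tangent p] is literally ['rV[R]_n],
    so [Em] is invertible and every [v] is a combination of the rows; pairing with [e i] identifies
    the coefficients. *)
Lemma orthonormal_expand p (e : 'I_n -> tangent p) (v : tangent p) :
  orthonormal g e -> v = \sum_i g p v (e i) *: e i.
Proof.
move=> eo.
pose Em : 'M[R]_n := \matrix_i (e i : 'rV[R]_n).
have mulE (u : 'rV[R]_n) : u *m Em = \sum_i u 0 i *: (e i : 'rV[R]_n).
  by rewrite mulmx_sum_row; apply: eq_bigr => i _; rewrite rowK.
have coef (u : 'rV[R]_n) j : g p (\sum_i u 0 i *: e i) (e j) = u 0 j.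
  rewrite (fm_suml gm) (bigD1 j) //= big1 => [|i ij].
    by rewrite (fm_Zl gm) eo eqxx mulr1 addr0.
  by rewrite (fm_Zl gm) eo (negbTE ij) mulr0.
have Eu : Em \in unitmx.
  rewrite -row_free_unit; apply/row_freeP.
  apply/row_freeP; rewrite -kermx_eq0; apply/rowV0P => u /sub_kermxP uE.
  by apply/rowP => j; rewrite -coef -[\sum_i _]mulE uE (fm_0l gm) mxE.
have vE : v = \sum_i ((v : 'rV[R]_n) *m invmx Em) 0 i *: e i.
  by rewrite -mulE -mulmxA mulVmx // mulmx1.
by rewrite {1}vE; apply: eq_bigr => i _; rewrite {2}vE coef.
Qed.

(** Expand each [e' i] in [e] and sum over [i] with Parseval's identity for [e']: the coefficient
    matrix contracts to the identity. Values in an arbitrary module let it serve both the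
    bundle-valued Dirac operator and the real-valued Laplacian. *)
Lemma orthonormal_trace p (W : lmodType R) (B : tangent p -> tangent p -> W)
    (e e' : 'I_n -> tangent p) :
  (forall a u v w, B (a *: u + v) w = a *: B u w + B v w) ->
  (forall a u v w, B w (a *: u + v) = a *: B w u + B w v) ->
  orthonormal g e -> orthonormal g e' ->
  \sum_i B (e i) (e i) = \sum_i B (e' i) (e' i).
Proof.
move=> Bl Br eo eo'.
have B0l w : B 0 w = 0.
  by have := Bl 1 0 0 w; rewrite scaler0 addr0 scale1r => /addrr_eq0.
have B0r w : B w 0 = 0.
  by have := Br 1 0 0 w; rewrite scaler0 addr0 scale1r => /addrr_eq0.
have Bsl (a : 'I_n -> R) (u : 'I_n -> tangent p) w :
    B (\sum_i a i *: u i) w = \sum_i a i *: B (u i) w.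
  by apply: (big_rec2 (fun x y => B x w = y)) => // i x y _ <-; rewrite Bl.
have Bsr (a : 'I_n -> R) (u : 'I_n -> tangent p) w :
    B w (\sum_i a i *: u i) = \sum_i a i *: B w (u i).
  by apply: (big_rec2 (fun x y => B w x = y)) => // i x y _ <-; rewrite Br.
have parseval u w : \sum_i g p (e' i) u * g p (e' i) w = g p u w.
  rewrite [in RHS](orthonormal_expand w eo') (fm_sumr gm); apply: eq_bigr => i _.
  by rewrite (fm_Zr gm) mulrC (fm_sym gm w) (fm_sym gm u).
under [RHS]eq_bigr => i _.
  rewrite [X in B X _](orthonormal_expand (e' i) eo) Bsl.
  under eq_bigr => j _ do rewrite [X in B _ X](orthonormal_expand (e' i) eo) Bsr scaler_sumr.
  over.
rewrite exchange_big /=; apply: eq_bigr => j _; rewrite exchange_big /=.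
rewrite (bigD1 j) //= [X in _ + X]big1 => [|k kj].
  under eq_bigr do rewrite scalerA.
  by rewrite addr0 -scaler_suml parseval eo eqxx scale1r.
under eq_bigr do rewrite scalerA.
by rewrite -scaler_suml parseval eo eq_sym (negbTE kj) scale0r.
Qed.

Let free_at (e : 'I_n -> vector_field M) q :=
  forall a : 'I_n -> R, \sum_i a i *: e i q = 0 -> forall i, a i = 0.

(** Only the field of index [K] changes: it becomes [w / |w|], where [w] is [e K] minus its
    projection on the earlier fields. Independence of all [n] fields is kept as an invariant because
    it is what makes [w] nonzero in the following steps. *)
Lemma gram_schmidt_step (U : set M) (e : 'I_n -> vector_field M) (K : 'I_n) :
  open U -> (forall i, smooth_vf U (e i)) -> (forall q, U q -> free_at e q) ->
  (forall q, U q -> forall i j : 'I_n, (i < K)%N -> (j < K)%N ->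
     g q (e i q) (e j q) = (i == j)%:R) ->
  exists e' : 'I_n -> vector_field M,
  [/\ forall i, smooth_vf U (e' i), forall q, U q -> free_at e' q &
      forall q, U q -> forall i j : 'I_n, (i <= K)%N -> (j <= K)%N ->
     g q (e' i q) (e' j q) = (i == j)%:R].
Proof.
move=> oU es ef eo.
pose b i q := if i == K then 1 else if (i < K)%N then - g q (e K q) (e i q) else 0.
pose w : vector_field M := fun q => \sum_i b i q *: e i q.
have bs i : smooth_fun U (b i).
  rewrite /b; case: (i == K); first exact: smooth_fun_cst.
  case: (i < K)%N; last exact: smooth_fun_cst.
  by apply: smooth_funN => //; exact: (fm_smooth gm).
have ws : smooth_vf U w by exact: smooth_vf_sum.
have wpos q : U q -> 0 < g q (w q) (w q).
  move=> Uq; apply: (fm_pos gm (p := q)); apply/eqP => w0.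
  have /eqP := ef q Uq (b^~ q) w0 K.
  by rewrite /b eqxx oner_eq0.
pose r q := (Num.sqrt (g q (w q) (w q)))^-1.
have rs : smooth_fun U r.
  by apply: smooth_fun_invsqrt => //; exact: (fm_smooth gm).
have r0 q : U q -> r q != 0.
  by move=> Uq; rewrite invr_eq0 gt_eqF// sqrtr_gt0 wpos.
have rw q : U q -> r q * (r q * g q (w q) (w q)) = 1.
  move=> Uq; have := wpos _ Uq; rewrite /r; set x := g q (w q) (w q) => x0.
  rewrite -{3}(sqr_sqrtr (ltW x0)) expr2 mulKf ?mulVf //.
    by rewrite gt_eqF// sqrtr_gt0.
  by rewrite gt_eqF// sqrtr_gt0.
have wo q (i : 'I_n) : U q -> (i < K)%N -> g q (w q) (e i q) = 0.
  move=> Uq iK; rewrite /w (fm_suml gm) (bigD1 K) //= (bigD1 i) /=; last first.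
    by rewrite neq_ltn iK.
  rewrite big1 => [|j /andP[jK ji]].
    rewrite !(fm_Zl gm) /b eqxx (eo q Uq i i) // eqxx iK.
    have [iK'|_] := eqVneq i K; first by rewrite iK' ltnn in iK.
    by rewrite mul1r mulr1 addr0 subrr.
  rewrite (fm_Zl gm) /b (negbTE jK); case: ifP => jK'; last by rewrite mul0r.
  by rewrite (eo q Uq j i) // (negbTE ji) mulr0.
exists (fun i q => if i == K then r q *: w q else e i q); split.
- by move=> i; case: (i == K) => //; exact: smooth_vfZ.
- move=> q Uq a a0.
  (* A relation with coefficients [a] among the new fields is the relation with coefficients [a']
     among the old ones; its coefficient at [K] is [a K * r q]. *)
  pose a' i := (if i == K then 0 else a i) + a K * r q * b i q.
  have a'0 i : a' i = 0.
    apply: (ef q Uq); rewrite -[RHS]a0.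
    under eq_bigr do rewrite scalerDl -scalerA.
    rewrite big_split /= -scaler_sumr -/(w q) -scalerA [RHS](bigD1 K) //= eqxx addrC.
    congr (_ + _); rewrite (bigD1 K) //= eqxx scale0r add0r.
    by apply: eq_bigr => j jK; rewrite (negbTE jK).
  have aK : a K = 0.
    have /eqP := a'0 K; rewrite /a' /b eqxx mulr1 add0r mulf_eq0 (negbTE (r0 q Uq)) orbF.
    by move/eqP.
  move=> i; have := a'0 i; rewrite /a' aK !mul0r addr0.
  by case: eqP => [->|].
- move=> q Uq i j; rewrite (leq_eqVlt i) (leq_eqVlt j) => /orP[iK|iK] /orP[jK|jK].
  + have -> : i = K by exact/val_inj/eqP.
    have -> : j = K by exact/val_inj/eqP.
    by rewrite eqxx (fm_Zl gm) (fm_Zr gm) rw.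
  + have -> : i = K by exact/val_inj/eqP.
    have jK' : (K == j) = false by rewrite eq_sym -val_eqE ltn_eqF.
    by rewrite eqxx (fm_Zl gm) eq_sym jK' wo // mulr0.
  + have -> : j = K by exact/val_inj/eqP.
    have iK' : (i == K) = false by rewrite -val_eqE ltn_eqF.
    by rewrite iK' eqxx (fm_Zr gm) (fm_sym gm) wo // mulr0.
  + have iK' : (i == K) = false by rewrite -val_eqE ltn_eqF.
    have jK' : (j == K) = false by rewrite -val_eqE ltn_eqF.
    by rewrite iK' jK' eo.
Qed.

(** Gram-Schmidt starts from the coordinate fields of [chart_at p] and takes place on the whole
    chart domain; [k] counts the fields already orthonormal. *)
Lemma orthonormal_frame_atP p : exists U,
  [/\ open U, U p & local_orthonormal_frame g U (orthonormal_frame_at g p)].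
Proof.
apply: (xgetPex (fun _ _ => 0)
    (P := [set e | exists U, [/\ open U, U p & local_orthonormal_frame g U e]])).
set c := chart_at p.
have ac : atlas c by exact: atlas_chart_at.
suff H k : (k <= n)%N -> exists e : 'I_n -> vector_field M,
    [/\ forall i, smooth_vf (cdom c) (e i), forall q, cdom c q -> free_at e q &
      forall q, cdom c q -> forall i j : 'I_n, (i < k)%N -> (j < k)%N ->
     g q (e i q) (e j q) = (i == j)%:R].
  have [e [es _ eo]] := H n (leqnn n).
  exists e, (cdom c); split; [exact: cdom_open|exact: cdom_chart_at|split=> // q cq i j].
  by apply: eo.
elim: k => [_|k IH kn].
  exists (coord_vf c); split=> [i|q cq a a0 i|//]; first exact: smooth_coord_vf.
  have : tcoord c (\sum_i a i *: coord_vf c i q) = \sum_i a i *: delta_mx 0 i.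
    apply: (big_rec2 (fun x y => tcoord c x = y)) => [|j x y _ <-].
      by have := @tcoord_linear _ _ _ c q 1 0 0 ac cq; rewrite scaler0 addr0 scale1r => /addrr_eq0.
    by rewrite tcoord_linear // tcoord_coord_vf_id.
  rewrite a0 => /rowP /(_ i); rewrite summxE (bigD1 i) //= big1 => [|j ji].
    rewrite !mxE !eqxx mulr1 addr0 => <-.
    have := @tcoord_linear _ _ _ c q 1 0 0 ac cq; rewrite scaler0 addr0 scale1r.
    by move=> /addrr_eq0 ->; rewrite mxE.
  by rewrite !mxE [i == j]eq_sym (negbTE ji) andbF mulr0.
have [e [es ef eo]] := IH (ltnW kn).
exact: (gram_schmidt_step (K := Ordinal kn) (@cdom_open _ _ _ c) es ef eo).
Qed.

End Frames.

(** * Smooth sections of a vector bundle *)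

Section SmoothSections.
Context {R : realType} {n : nat} {M : manifold R n} {E : M -> lmodType R}.
Context (F : set (local_frame E)).
Implicit Types (U : set M) (s t : forall p, E p).

Lemma smooth_section_subset U U' s :
  U' `<=` U -> smooth_section F U s -> smooth_section F U' s.
Proof.
move=> UU ss f Ff; have [a as_ sE] := ss f Ff; exists a.
  by apply: smooth_fun_subset as_ => q [/UU].
by move=> p /UU; exact: sE.
Qed.

Lemma smooth_section_congr U s t : (forall q, U q -> s q = t q) ->
  smooth_section F U s -> smooth_section F U t.
Proof.
move=> st ss f Ff; have [a as_ sE] := ss f Ff; exists a => // p Up.
by rewrite -st //; exact: sE.
Qed.

Lemma smooth_sectionZD U (f : M -> R) s t : open U -> smooth_fun U f ->
  smooth_section F U s -> smooth_section F U t ->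
  smooth_section F U (fun q => f q *: s q + t q).
Proof.
move=> oU fs ss ts fr Ffr; have [a as_ sE] := ss fr Ffr; have [b bs tE] := ts fr Ffr.
have oUf : open (U `&` fdom fr) by apply: openI => //; exact: fdom_open.
have fs' : smooth_fun (U `&` fdom fr) f by apply: smooth_fun_subset fs => q [].
exists (fun q => f q *: a q + b q).
  apply/(smooth_fun_rowP _ oUf) => j.
  apply: (smooth_fun_congr (f := fun q => f q * a q 0 j + b q 0 j)) => //.
    by move=> q _; rewrite !mxE.
  apply: smooth_funD => //; last exact: ((smooth_fun_rowP _ oUf).1 bs j).
  by apply: smooth_funM => //; exact: ((smooth_fun_rowP _ oUf).1 as_ j).
move=> p Up fp; rewrite (sE _ Up fp) (tE _ Up fp) scaler_sumr -big_split /=.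
by apply: eq_bigr => i _; rewrite !mxE scalerDl scalerA.
Qed.

Lemma smooth_section0 U : smooth_section F U (fun=> 0).
Proof.
move=> fr Ffr; exists (fun=> 0); first exact: smooth_fun_cst.
by move=> p _ _; rewrite big1 // => i _; rewrite mxE scale0r.
Qed.

Lemma smooth_section_sum U I (r : seq I) (s : I -> forall p, E p) : open U ->
  (forall i, smooth_section F U (s i)) ->
  smooth_section F U (fun q => \sum_(i <- r) s i q).
Proof.
move=> oU ss; elim: r => [|i r IH].
  by apply: smooth_section_congr (@smooth_section0 U) => q _; rewrite big_nil.
apply: smooth_section_congr (smooth_sectionZD oU (smooth_fun_cst U (1 : R)) (ss i) IH).
by move=> q _; rewrite big_cons scale1r.
Qed.

End SmoothSections.

(** * The Laplacian and the second derivative test *)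

Section SecondDerivativeTest.
Context {R : realType}.

(** If [l] were positive, [df] would vanish at 0 and be positive just to the right of it, and the
    mean value theorem would give [f t > f 0] for a small positive [t]. *)
Lemma second_derivative_max (f df : R -> R) (r l : R) : 0 < r ->
  (forall t : R, `|t| < r -> is_derive t (1 : R) f (df t)) ->
  is_derive (0 : R) (1 : R) df l ->
  (forall t, `|t| < r -> f t <= f 0) -> df 0 = 0 /\ l <= 0.
Proof.
move=> r0 fd ddf fmax.
have inr (t : R) : t \in `](- r), r[ -> `|t| < r by rewrite in_itv /= ltr_norml.
have z : (0 : R) \in `](- r), r[ by rewrite in_itv /= oppr_lt0 r0.
have df0 : df 0 = 0.
  have d0 : is_derive (0 : R) 1 f 0.
    apply: (@derive1_at_max R f (- r) r) => //.
    - by rewrite ltW // gtrN.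
    - by move=> t /inr/fd[].
    - by move=> t /inr/fmax.
  have [_ <-] := fd 0 (inr _ z); by case: d0.
split=> //; rewrite leNgt; apply/negP => l0.
case: ddf => /cvg_ex[/= l' dl'] dl.
have ll' : l' = l by rewrite -dl; apply/esym/cvg_lim.
rewrite ll' in dl'.
have : \forall h \near (0 : R)^', 0 < h^-1 * (df (h * 1 + 0) - df 0).
  by apply: (cvgr_gt l) => //; exact: dl'.
rewrite near_withinE near_nbhs => /nbhs_ballP [d /= d0 dP].
pose t := Num.min d r / 2.
have t0 : 0 < t by rewrite divr_gt0 // lt_min d0 r0.
have [td tr] : t < d /\ t < r.
  have : t < Num.min d r by rewrite ltr_pdivrMr // ltr_pMr ?ltr1n // lt_min d0 r0.
  by rewrite lt_min => /andP.
have dpos (s : R) : 0 < s -> s <= t -> 0 < df s.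
  move=> s0 st; have := dP s; rewrite -ball_normE /= sub0r normrN gtr0_norm //.
  move=> /(_ (le_lt_trans st td)); rewrite mulr1 addr0 df0 subr0 gt_eqF // => /(_ isT).
  by rewrite pmulr_rgt0 // invr_gt0.
have bnd (s : R) : s \in `[0, t] -> `|s| < r.
  by rewrite in_itv /= => /andP[s0 st]; rewrite ger0_norm // (le_lt_trans st).
have [||s sin E] := @MVT R f df 0 t t0.
- by move=> s sin; apply/fd/bnd; exact: subset_itv_oo_cc sin.
- by apply: derivable_within_continuous => s /bnd/fd[].
have := fmax t (bnd t _); rewrite -subr_le0 E subr0 in_itv /= lexx ltW // => /(_ isT).
move: sin; rewrite in_itv /= => /andP[s0 st].
by rewrite leNgt mulr_gt0 // dpos // ltW.
Qed.

Context {n : nat}.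

Lemma near_line (W : set 'rV[R]_n) (x v : 'rV[R]_n) : open W -> W x ->
  exists2 r : R, 0 < r & forall t, `|t| < r -> W (t *: v + x).
Proof.
move=> oW Wx.
have : \forall t \near (0 : R), W (t *: v + x).
  have c0 : {for (0 : R), continuous (fun t : R => t *: v + x)}.
    have d1 : is_derive (0 *: v + x) v (id : 'rV[R]_n -> 'rV[R]_n) v.
      exact: is_derive_id.
    apply: (@derivable_continuous_line _ _ _ id x v); exact: ex_derive.
  have := c0 W; rewrite /= scale0r add0r; apply.
  exact: open_nbhs_nbhs.
move=> /nbhs_ballP[r /= r0 rP]; exists r => // t tr; apply: rP.
by rewrite -ball_normE /= sub0r normrN.
Qed.

Lemma class_C_max_derive (W : set 'rV[R]_n) (f : 'rV[R]_n -> R) x :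
  open W -> W x -> class_C 2 W f -> (forall y, W y -> f y <= f x) ->
  (forall v, 'D_v f x = 0) /\
  (forall v : 'rV[R]_n, \sum_j v 0 j * 'D_v (fun y => 'D_(delta_mx 0 j) f y) x <= 0).
Proof.
move=> oW Wx fC fmax.
have P (v : 'rV[R]_n) : \sum_j v 0 j * 'D_(delta_mx 0 j) f x = 0 /\
    \sum_j v 0 j * 'D_v (fun y => 'D_(delta_mx 0 j) f y) x <= 0.
  have [r r0 rW] := near_line v oW Wx.
  pose F (t : R) := f (t *: v + x).
  pose F1 (t : R) := \sum_j v 0 j * 'D_(delta_mx 0 j) f (t *: v + x).
  have F0 : F 0 = f x by rewrite /F scale0r add0r.
  have -> : \sum_j v 0 j * 'D_(delta_mx 0 j) f x = F1 0.
    by rewrite /F1 scale0r add0r.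
  apply: (@second_derivative_max F F1 r) => // [t tr||t tr].
  - apply: is_derive_lineE.
    exact: (class_C_is_derive v oW (rW t tr) fC).
  - apply: is_derive_eq.
      apply: (@is_derive_lineE _ _ _ (fun y => \sum_j v 0 j * 'D_(delta_mx 0 j) f y) x v).
      rewrite scale0r add0r.
      rewrite (_ : (fun y => _) = \sum_j (fun y => v 0 j * 'D_(delta_mx 0 j) f y)).
        apply: is_derive_sum => j.
        apply: (@is_deriveM _ _ (cst (v 0 j)) (fun y => 'D_(delta_mx 0 j) f y)).
        apply: derivableP.
        have Cj : class_C 1 W (fun y => 'D_(delta_mx 0 j) f y) by case: fC => _ /(_ j)[].
        by have [] := class_C_is_derive v oW Wx Cj.
      by apply/funext => y; rewrite fct_sumE.
    by apply: eq_bigr => j _; rewrite scaler0 addr0.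
  - by rewrite F0; exact/fmax/rW.
split=> v; last by case: (P v).
by have [_ ->] := class_C_is_derive v oW Wx fC; case: (P v).
Qed.

End SecondDerivativeTest.

(** * The Laplacian of a function in a local frame *)

Section Laplacian.
Context {R : realType} {n : nat} {M : manifold R n} {g : riemannian_metric M}.
Context (lc : levi_civita g).
Let gm : fiber_metric (@smooth_vf R n M) g := rmet_metric g.
Let lcc : connection (@smooth_vf R n M) lc := (lc_metric lc).1.

(** In [X (X f)] the derivatives of the coefficients of [X] are multiplied by first derivatives of
    [f], which vanish at a maximum. What remains is the second derivative of [f] in the chart along
    [X p]. *)
Lemma tderive_max (U : set M) (f : M -> R) p : open U -> U p ->
  smooth_fun U f -> (forall q, U q -> f q <= f p) ->
  (forall v : tangent p, tderive v f = 0) /\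
  (forall X, smooth_vf U X -> tderive (X p) (fun q => tderive (X q) f) <= 0).
Proof.
move=> oU Up fs fmax; set c := chart_at p.
have ac : atlas c by exact: atlas_chart_at.
have cp : cdom c p by exact: cdom_chart_at.
pose W := cmap c @` (U `&` cdom c).
have oW : open W by exact: open_cimg.
have Wp : W (cmap c p) by exists p.
have FC k : class_C k W (f \o cinv c) by exact: fs.
have [|d1 d2] := class_C_max_derive oW Wp (FC 2).
  by move=> _ [q [Uq cq] <-] /=; rewrite !cmapK // fmax.
split=> [v|X Xs]; first exact: d1.
pose Xc j y := tcoord c (X (cinv c y)) 0 j.
have XC j : class_C 1 W (Xc j).
  have := Xs c ac c ac 1%N; rewrite -setIA setIid => XC.
  exact: (class_C_rowP _ _ oW).1 XC j.
have Dj j : class_C 1 W (fun y => 'D_(delta_mx 0 j) (f \o cinv c) y).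
  by case: (FC 2%N) => _ /(_ j)[].
have D : is_derive (cmap c p) (X p : 'rV[R]_n)
    (fun y => \sum_j Xc j y * 'D_(delta_mx 0 j) (f \o cinv c) y)
    (\sum_j (X p : 'rV[R]_n) 0 j *
       'D_(X p : 'rV[R]_n) (fun y => 'D_(delta_mx 0 j) (f \o cinv c) y) (cmap c p)).
  rewrite (_ : (fun y => _) = \sum_j (fun y => Xc j y * 'D_(delta_mx 0 j) (f \o cinv c) y)).
    apply: is_derive_eq.
      apply: is_derive_sum => j.
      apply: (@is_deriveM _ _ (Xc j) (fun y => 'D_(delta_mx 0 j) (f \o cinv c) y)).
        by apply: derivableP; have [] := class_C_is_derive (X p : 'rV[R]_n) oW Wp (XC j).
      by apply: derivableP; have [] := class_C_is_derive (X p : 'rV[R]_n) oW Wp (Dj j).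
    apply: eq_bigr => j _.
    by rewrite d1 scale0r addr0 /Xc cmapK // tcoord_chart_at.
  by apply/funext => y; rewrite fct_sumE.
have -> : tderive (X p) (fun q => tderive (X q) f) = \sum_j (X p : 'rV[R]_n) 0 j *
       'D_(X p : 'rV[R]_n) (fun y => 'D_(delta_mx 0 j) (f \o cinv c) y) (cmap c p).
  have [_ <-] := D; apply: near_eq_derive.
  apply: filterS (near_cimg oU Up cp) => _ [q [Uq cq ->]] /=.
  by rewrite cmapK // (tderive_chart _ ac cq oU Uq fs) /Xc cmapK.
exact: d2.
Qed.

(** For an orthonormal [e] this is the trace of the covariant Hessian of [f], with the sign that
    makes it nonpositive at a maximum. *)
Definition laplacian (e : 'I_n -> vector_field M) (f : M -> R) p : R :=
  \sum_i (tderive (e i p) (fun q => tderive (e i q) f) -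
          tderive (lc p (e i p) (e i)) f).

Lemma laplacian_max (U : set M) e (f : M -> R) p : open U -> U p ->
  (forall i, smooth_vf U (e i)) ->
  smooth_fun U f -> (forall q, U q -> f q <= f p) -> laplacian e f p <= 0.
Proof.
move=> oU Up es fs fmax; apply: sumr_le0 => i _.
have [d1 d2] := tderive_max oU Up fs fmax.
by rewrite d1 subr0 d2.
Qed.

Lemma smooth_laplacian (U : set M) e (f : M -> R) : open U ->
  (forall i, smooth_vf U (e i)) -> smooth_fun U f ->
  smooth_fun U (laplacian e f).
Proof.
move=> oU es fs; apply: smooth_fun_sum => // i; apply: smooth_funD => //.
  by apply: smooth_fun_tderive => //; exact: smooth_fun_tderive.
apply: smooth_funN => //; apply: smooth_fun_tderive => //.
exact: (cn_smooth lcc).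
Qed.

Lemma laplacianD (U : set M) e (f h : M -> R) p : open U -> U p ->
  (forall i, smooth_vf U (e i)) -> smooth_fun U f -> smooth_fun U h ->
  laplacian e (fun q => f q + h q) p = laplacian e f p + laplacian e h p.
Proof.
move=> oU Up es fs hs; rewrite -big_split /=; apply: eq_bigr => i _.
rewrite (tderiveD _ oU Up fs hs) opprD addrACA; congr (_ + _).
rewrite -(tderiveD _ oU Up); try exact: smooth_fun_tderive.
by apply: (tderive_congr _ oU Up) => q Uq; rewrite (tderiveD _ oU Uq fs hs).
Qed.

Lemma tderiveZ (U : set M) (a : R) (f : M -> R) p (v : tangent p) : open U -> U p ->
  smooth_fun U f -> tderive v (fun q => a * f q) = a * tderive v f.
Proof.
move=> oU Up fs.
by rewrite (tderiveM _ oU Up (smooth_fun_cst U a) fs) tderive_cst mulr0 addr0.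
Qed.

Lemma laplacianZ (U : set M) e (a : R) (f : M -> R) p : open U -> U p ->
  (forall i, smooth_vf U (e i)) -> smooth_fun U f ->
  laplacian e (fun q => a * f q) p = a * laplacian e f p.
Proof.
move=> oU Up es fs; rewrite mulr_sumr; apply: eq_bigr => i _.
rewrite (tderiveZ _ _ oU Up fs) mulrBr; congr (_ - _).
rewrite -(tderiveZ _ _ oU Up); try exact: smooth_fun_tderive.
by apply: (tderive_congr _ oU Up) => q Uq; rewrite (tderiveZ _ _ oU Uq fs).
Qed.

Lemma laplacian_locally_cst (U : set M) e (f : M -> R) p : open U -> U p ->
  (forall q, U q -> f q = f p) -> laplacian e f p = 0.
Proof.
move=> oU Up fE.
have d q (v : tangent q) : U q -> tderive v f = 0.
  by move=> Uq; rewrite (tderive_congr v oU Uq fE) tderive_cst.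
rewrite /laplacian big1 // => i _; rewrite d // subr0.
by rewrite (tderive_congr _ oU Up (g := fun=> 0)) ?tderive_cst // => q /d.
Qed.

Lemma laplacianX (U : set M) e (w : M -> R) m p : open U -> U p ->
  (forall i, smooth_vf U (e i)) -> smooth_fun U w ->
  laplacian e (fun q => w q ^+ m.+2) p =
    m.+2%:R * w p ^+ m * (m.+1%:R * (\sum_i tderive (e i p) w ^+ 2) +
                          w p * laplacian e w p).
Proof.
move=> oU Up es ws.
rewrite /laplacian mulrDr !mulr_sumr -big_split /=; apply: eq_bigr => i _.
rewrite (tderiveX _ _ oU Up ws).
rewrite (tderive_congr _ oU Up (g := fun q => m.+2%:R * (w q ^+ m.+1 * tderive (e i q) w))).
  have es' := smooth_fun_tderive oU ws (es i).
  rewrite (tderiveZ _ _ oU Up); last by apply: smooth_funM => //; exact: smooth_funX.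
  rewrite (tderiveM _ oU Up (smooth_funX _ oU ws) es') (tderiveX _ _ oU Up ws) exprS.
  ring.
by move=> q Uq; rewrite (tderiveX _ _ oU Uq ws) mulrA.
Qed.

(** [G e] is the gradient of [f], characterized by [g (G e) v = v f] and hence the same for both
    frames. The Laplacian is the trace of [v |-> nabla_v (G e)], to which [orthonormal_trace]
    applies. *)
Lemma laplacian_frame_indep (U : set M) e e' (f : M -> R) p : open U -> U p ->
  local_orthonormal_frame g U e -> local_orthonormal_frame g U e' ->
  smooth_fun U f -> laplacian e f p = laplacian e' f p.
Proof.
move=> oU Up [es eo] [es' eo'] fs.
pose G (e : 'I_n -> vector_field M) : vector_field M :=
  fun q => \sum_k tderive (e k q) f *: e k q.
have GE (b : 'I_n -> vector_field M) q (v : tangent q) : U q ->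
    orthonormal g (fun i => b i q) -> g q (G b q) v = tderive v f.
  move=> Uq bo; rewrite {2}(orthonormal_expand v bo) /G (fm_suml gm).
  transitivity (\sum_i g q v (b i q) * tderive (b i q) f).
    by apply: eq_bigr => i _; rewrite (fm_Zl gm) mulrC (fm_sym gm).
  apply/esym; apply: (big_rec2 (fun x y => tderive x f = y)) => [|i x y _ <-].
    exact: (tderive0 oU Uq fs).
  exact: (tderive_linear _ _ _ oU Uq fs).
have Gs (b : 'I_n -> vector_field M) : (forall i, smooth_vf U (b i)) -> smooth_vf U (G b).
  by move=> bs; apply: smooth_vf_sum => // i; exact: smooth_fun_tderive.
(* Metric compatibility gives [b_i (b_i f) = b_i (g G b_i) = g (nabla_{b_i} G) b_i + (nabla_{b_i}
   b_i) f], and the correction term of [laplacian] removes the last summand. *)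
have lapE (b : 'I_n -> vector_field M) : (forall i, smooth_vf U (b i)) ->
    (forall q, U q -> orthonormal g (fun i => b i q)) ->
    laplacian b f p = \sum_i g p (lc p (b i p) (G b)) (b i p).
  move=> bs bo; apply: eq_bigr => i _.
  rewrite (tderive_congr _ oU Up (g := fun q => g q (G b q) (b i q))) => [|q Uq].
    rewrite ((lc_metric lc).2 U) //; last exact: Gs.
    by rewrite (GE _ _ _ Up (bo _ Up)) addrK.
  by rewrite GE //; exact: bo.
rewrite !lapE //.
have -> := @orthonormal_trace _ _ _ g p R^o (fun v w => g p (lc p v (G e)) w)
  (fun i => e i p) (fun i => e' i p) _ _ (eo _ Up) (eo' _ Up).
- apply: eq_bigr => i _; congr (g p _ _).
  apply: (cn_local lcc _ oU Up (Gs _ es)) => q Uq.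
  rewrite (orthonormal_expand (G e q) (eo _ Uq)) [RHS](orthonormal_expand _ (eo _ Uq)).
  by apply: eq_bigr => k _; rewrite !GE //; [exact: eo'|exact: eo].
- by move=> a u v w; rewrite (cn_linear lcc _ _ _ oU Up (Gs _ es)) (fm_linear gm).
- by move=> a u v w; rewrite (fm_Dr gm) (fm_Zr gm).
Qed.

End Laplacian.

(** * The strong maximum principle *)

Section EuclideanDistance.
Context {R : realType} {n : nat}.
Implicit Types x y z : 'rV[R]_n.

(** The norm of ['rV[R]_n] is the sup norm. The touching-ball argument wants round balls and a
    smooth distance, hence the squared Euclidean distance beside it. *)
Definition sqdist x y : R := \sum_j (x 0 j - y 0 j) ^+ 2.

Lemma sqdistC x y : sqdist x y = sqdist y x.
Proof. by apply: eq_bigr => j _; rewrite -sqrrN opprB. Qed.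

Lemma sqdistxx x : sqdist x x = 0.
Proof. by rewrite /sqdist big1 // => j _; rewrite subrr expr0n. Qed.

Lemma sqdist_ge0 x y : 0 <= sqdist x y.
Proof. by apply: sumr_ge0 => j _; exact: sqr_ge0. Qed.

Lemma sqdist_gt0 x y : x != y -> 0 < sqdist x y.
Proof.
move=> xy; rewrite lt_def sqdist_ge0 andbT; apply: contra_neq xy => d0.
apply/rowP => j; apply/eqP; rewrite -subr_eq0 -sqrf_eq0; apply/eqP.
move/eqP: d0; rewrite psumr_eq0 => [/allP /(_ j)|i _]; last exact: sqr_ge0.
by rewrite mem_index_enum => /(_ isT) /eqP.
Qed.

Lemma norm_lt_sqdist x y (s : R) : 0 < s -> sqdist x y < s ^+ 2 -> `|x - y| < s.
Proof.
move=> s0 ds; rewrite [ltLHS]/Num.Def.normr/= mx_normrE.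
apply: bigmax_lt => // -[i j] _ /=; rewrite ord1 !mxE.
rewrite -(ltr_pXn2r (n := 2)) ?nnegrE ?normr_ge0 ?(ltW s0) //; apply: le_lt_trans ds.
rewrite -normrX ger0_norm ?sqr_ge0 // /sqdist (bigD1 j) //= lerDl.
by apply: sumr_ge0 => k _; exact: sqr_ge0.
Qed.

Lemma sqdist_continuous x : continuous (sqdist^~ x).
Proof.
have -> : sqdist^~ x = \sum_j (fun y : 'rV[R]_n => (y 0 j - x 0 j) ^+ 2).
  by apply/funext => y; rewrite fct_sumE.
apply: (@big_rec _ (fun f : 'rV[R]_n -> R => continuous f)) => [|j f _ fc] y.
  exact: cst_continuous.
apply: continuousD; last exact: fc.
apply: (@continuous_comp _ _ _ (fun y : 'rV[R]_n => y 0 j - x 0 j) (fun r : R => r ^+ 2)).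
  apply: (@continuousB _ _ _ (fun y : 'rV[R]_n => y 0 j) (cst (x 0 j))).
    exact: coord_continuous.
  exact: cst_continuous.
exact: exprn_continuous.
Qed.

(* By the parallelogram identity, the ball with diameter [x1, y1] is inside the
   ball of centre [x1] through [y1] and touches its boundary only at [y1]. *)
Lemma sqdist_inner_ball x1 y1 y : let x0 := 2^-1 *: (x1 + y1) in
  y != y1 -> sqdist y x0 <= sqdist y1 x0 -> sqdist y x1 < sqdist y1 x1.
Proof.
move=> x0 yy1 le0.
have E : sqdist y x1 = 2 * sqdist y x0 + 2 * sqdist y1 x0 - sqdist y y1.
  rewrite !mulr_sumr -big_split /= -sumrB; apply: eq_bigr => j _.
  by rewrite !mxE; field.
have E1 : sqdist y1 x1 = 4 * sqdist y1 x0.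
  by rewrite mulr_sumr; apply: eq_bigr => j _; rewrite !mxE; field.
have := sqdist_gt0 yy1; rewrite E E1; lra.
Qed.

Lemma closed_norm_ball x (r : R) : closed [set y | `|y - x| <= r].
Proof.
apply: (@closed_comp _ _ (fun y => `|y - x|) [set t : R | t <= r]); last exact: closed_le.
move=> y _; apply: (@continuous_comp _ _ _ (fun y => y - x) (@Num.norm _ 'rV[R]_n)).
  by apply: (@continuousB _ _ _ id (cst x)); [by move=> ?|exact: cst_continuous].
exact: norm_continuous.
Qed.

Lemma closed_norm_ge x (r : R) : closed [set y | r <= `|y - x|].
Proof.
apply: (@closed_comp _ _ (fun y => `|y - x|) [set t : R | r <= t]); last exact: closed_ge.
move=> y _; apply: (@continuous_comp _ _ _ (fun y => y - x) (@Num.norm _ 'rV[R]_n)).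
  by apply: (@continuousB _ _ _ id (cst x)); [by move=> ?|exact: cst_continuous].
exact: norm_continuous.
Qed.

Lemma closed_sqdist_le x (r : R) : closed [set y | sqdist y x <= r].
Proof.
apply: (@closed_comp _ _ (sqdist^~ x) [set t : R | t <= r]); last exact: closed_le.
by move=> y _; exact: sqdist_continuous.
Qed.

Lemma compact_norm_ball x (r : R) : compact [set y | `|y - x| <= r].
Proof.
apply: bounded_closed_compact; last exact: closed_norm_ball.
exists (r + `|x|); split; first exact: num_real.
move=> M rM y /= yr; apply: le_trans (ltW rM).
by rewrite -[y](subrK x) (le_trans (ler_normD _ _)) // lerD2r.
Qed.

End EuclideanDistance.

Arguments closed_norm_ball {R n} x r.
Arguments closed_norm_ge {R n} x r.
Arguments closed_sqdist_le {R n} x r.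
Arguments compact_norm_ball {R n} x r.

(** * Extrema on compact sets *)

Section Compact.
Context {R : realType} {T : topologicalType}.

Lemma compact_argmax (A : set T) (f : T -> R) : A !=set0 -> compact A ->
  (forall x, A x -> {for x, continuous f}) ->
  exists2 c, A c & forall x, A x -> f x <= f c.
Proof.
move=> A0 cA fc; have [|c cA' cP] := @compact_EVT_max T R f A A0 cA.
  by apply: continuous_in_subspaceT => x; rewrite inE; exact: fc.
by exists c; [rewrite inE in cA'|move=> x Ax; apply: cP; rewrite inE].
Qed.

Lemma compact_argmin (A : set T) (f : T -> R) : A !=set0 -> compact A ->
  (forall x, A x -> {for x, continuous f}) ->
  exists2 c, A c & forall x, A x -> f c <= f x.
Proof.
move=> A0 cA fc; have [|c cA' cP] := @compact_EVT_min T R f A A0 cA.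
  by apply: continuous_in_subspaceT => x; rewrite inE; exact: fc.
by exists c; [rewrite inE in cA'|move=> x Ax; apply: cP; rewrite inE].
Qed.

Lemma compact_lt_gap (A : set T) (f : T -> R) m : compact A ->
  (forall x, A x -> {for x, continuous f}) -> (forall x, A x -> f x < m) ->
  exists2 d, 0 < d & forall x, A x -> f x <= m - d.
Proof.
move=> cA fc fm; have [A0|/set0P A0] := eqVneq A set0.
  by exists 1 => // x; rewrite A0.
have [c Ac cP] := compact_argmax A0 cA fc.
exists (m - f c); first by rewrite subr_gt0 fm.
by move=> x /cP; rewrite subKr.
Qed.

Lemma closedI_preimage (A : set T) (f : T -> R) (C : set R) : closed A -> closed C ->
  (forall x, A x -> {for x, continuous f}) -> closed (A `&` f @^-1` C).
Proof.
move=> cA cC fc x clx.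
have Ax : A x by apply: cA => B /clx [y [[Ay _] By]]; exists y.
split=> //; apply: contrapT => fxC.
have : nbhs x (f @^-1` ~` C).
  by apply: (fc _ Ax); apply: open_nbhs_nbhs; split=> //; exact: closed_openC.
by move=> /clx [y [[_ Cy] nCy]].
Qed.

End Compact.

(** * The barrier function of a coordinate ball *)

Section Barrier.
Context {R : realType} {n : nat} {M : manifold R n} {g : riemannian_metric M}.

(** Its superlevel sets are round coordinate balls about [x0]. A high power of it plays the part of
    the classical Hopf barrier [exp (- a r^2)], and is a polynomial in the coordinate functions. *)
Definition barrier (c : chart R n M) (x0 : 'rV[R]_n) (K : R) (q : M) : R :=
  K - sqdist (cmap c q) x0.

Lemma smooth_barrier c x0 K : atlas c -> smooth_fun (cdom c) (barrier c x0 K).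
Proof.
move=> ac; have oc := @cdom_open _ _ _ c.
apply: smooth_funD => //; first exact: smooth_fun_cst.
apply: smooth_funN => //; apply: smooth_fun_sum => // j.
apply: smooth_funX => //; apply: smooth_funD => //; first exact: smooth_cmap.
exact: smooth_fun_cst.
Qed.

Lemma tderive_barrier c x0 K q (v : tangent q) : atlas c -> cdom c q ->
  tderive v (barrier c x0 K) =
  - \sum_j 2 * (cmap c q 0 j - x0 0 j) * tcoord c v 0 j.
Proof.
move=> ac cq; have oc := @cdom_open _ _ _ c.
have s1 j : smooth_fun (cdom c) (fun q => cmap c q 0 j - x0 0 j).
  by apply: smooth_funD => //; [exact: smooth_cmap|exact: smooth_fun_cst].
have s2 : smooth_fun (cdom c) (fun q => sqdist (cmap c q) x0).
  by apply: smooth_fun_sum => // j; exact: smooth_funX.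
rewrite (tderiveD _ oc cq (smooth_fun_cst _ K) (smooth_funN oc s2)).
rewrite tderive_cst add0r (tderiveN _ oc cq s2); congr (- _).
rewrite (tderive_sum _ oc cq) => [|j]; last exact: smooth_funX.
apply: eq_bigr => j _; rewrite (tderiveX _ _ oc cq (s1 j)) expr1; congr (_ * _).
rewrite (tderiveD _ oc cq (smooth_cmap j ac) (smooth_fun_cst _ _)).
by rewrite tderive_cst addr0 tcoordE.
Qed.

(** If all derivatives along the frame vanish, so do those along the coordinate fields, which are
    [-2 (x_j - x0_j)]; then [q] sits at the centre. *)
Lemma barrier_gradient_gt0 c x0 K q (e : 'I_n -> tangent q) : atlas c -> cdom c q ->
  orthonormal g e -> cmap c q != x0 ->
  0 < \sum_i tderive (e i) (barrier c x0 K) ^+ 2.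
Proof.
move=> ac cq eo qx0; have oc := @cdom_open _ _ _ c.
have ws := smooth_barrier x0 K ac.
rewrite lt_def sumr_ge0 ?andbT => [|i _]; last exact: sqr_ge0.
apply: contra_neq qx0 => N0.
have d0 i : tderive (e i) (barrier c x0 K) = 0.
  move/eqP: N0; rewrite psumr_eq0 => [/allP /(_ i)|k _]; last exact: sqr_ge0.
  by rewrite mem_index_enum => /(_ isT); rewrite sqrf_eq0 => /eqP.
have dv (v : tangent q) : tderive v (barrier c x0 K) = 0.
  rewrite (orthonormal_expand v eo).
  apply: (big_rec (fun x => tderive x (barrier c x0 K) = 0)) => [|i x _ x0'].
    exact: (tderive0 oc cq ws).
  by rewrite (tderive_linear _ _ _ oc cq ws) d0 mulr0 x0' addr0.
apply/rowP => j; apply/eqP; rewrite -subr_eq0.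
have := dv (coord_vf c j q); rewrite tderive_barrier // tcoord_coord_vf_id //.
rewrite (bigD1 j) //= big1 => [|i ij]; last first.
  by rewrite !mxE (negbTE ij) andbF mulr0.
rewrite !mxE !eqxx mulr1 addr0 => /eqP; rewrite oppr_eq0 mulf_eq0.
by rewrite pnatr_eq0.
Qed.

End Barrier.

(** * Hopf's argument inside a chart *)

Section Hopf.
Context {R : realType} {n : nat} {M : manifold R n} {g : riemannian_metric M}.
Context (lc : levi_civita g).
Context {c : chart R n M} {U : set M} {e : 'I_n -> vector_field M} {f : M -> R}.
Hypotheses (ac : atlas c) (oU : open U) (Uc : U `<=` cdom c).
Hypotheses (eU : local_orthonormal_frame g U e) (fs : smooth_fun U f).
Hypothesis flap : forall q, U q -> 0 <= laplacian lc e f q.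

Let W := cmap c @` (U `&` cdom c).

Let cU x : W x -> U (cinv c x) /\ cmap c (cinv c x) = x.
Proof. by move=> [q [Uq cq] <-]; rewrite !cmapK. Qed.

Let W_continuous (h : M -> R) x : smooth_fun U h -> W x ->
  {for x, continuous (h \o cinv c)}.
Proof.
by move=> hs [q [Uq cq] <-]; exact: smooth_fun_continuous hs ac Uq cq.
Qed.

(* [laplacian e (w ^+ k.+2)] is a positive multiple of [k.+1%:R * |dw| ^+ 2 + w * laplacian e w],
   so a large exponent makes the power of the barrier strictly subharmonic. *)
Lemma barrier_exponent (A : set 'rV[R]_n) (x0 : 'rV[R]_n) : A !=set0 -> compact A ->
  A `<=` W -> ~ A x0 ->
  exists K k, forall x, A x ->
    0 < K - sqdist x x0 /\
    0 < laplacian lc e (fun q => barrier c x0 K q ^+ k.+2) (cinv c x).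
Proof.
move=> A0 cA AW Ax0.
have [xK AxK xKP] := compact_argmax A0 cA (fun x _ => @sqdist_continuous _ _ x0 x).
(* The summand 1 keeps the barrier positive even at the point of [A] farthest from [x0]. *)
pose K := sqdist xK x0 + 1; pose w := barrier c x0 K.
have wpos x : A x -> 0 < K - sqdist x x0.
  by move=> /xKP h; rewrite subr_gt0 /K ltr_pwDr.
have ws : smooth_fun U w by apply: smooth_fun_subset Uc _; exact: smooth_barrier.
have [es eo] := eU.
pose N q := \sum_i tderive (e i q) w ^+ 2.
have Ns : smooth_fun U N.
  apply: smooth_fun_sum => // i; apply: smooth_funX => //.
  exact: smooth_fun_tderive.
have Npos x : A x -> 0 < (N \o cinv c) x.
  move=> Ax; have [Uq xE] := cU (AW _ Ax).
  apply: barrier_gradient_gt0 => //; [exact: Uc|exact: eo|rewrite xE].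
  by apply/eqP => xx0; rewrite xx0 in Ax.
pose L q := w q * laplacian lc e w q.
have Ls : smooth_fun U L by apply: smooth_funM => //; exact: smooth_laplacian.
have [xN AxN xNP] := compact_argmin A0 cA (fun x Ax => W_continuous Ns (AW _ Ax)).
have [xL AxL xLP] := compact_argmin A0 cA (fun x Ax => W_continuous Ls (AW _ Ax)).
set N0 := (N \o cinv c) xN in xNP; set L0 := (L \o cinv c) xL in xLP.
have N00 : 0 < N0 by exact: Npos.
(* [N0] and [L0] are the minima over [A] of the squared gradient of [w] and of [w] times its
   Laplacian; this [k] gives [k.+1 * N0 > |L0|]. *)
pose k := Num.bound (`|L0| / N0).
exists K, k => x Ax; split; first exact: wpos.
have [Uq xE] := cU (AW _ Ax).
rewrite (laplacianX _ _ oU Uq es ws) mulr_gt0 // -/(N (cinv c x)) -/(L (cinv c x)).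
  rewrite mulr_gt0 ?ltr0n // exprn_gt0 //.
  by rewrite /w /barrier xE wpos.
have kN : `|L0| < k.+1%:R * N0.
  rewrite -ltr_pdivrMr //.
  have := archi_boundP (divr_ge0 (normr_ge0 L0) (ltW N00)).
  by move/lt_le_trans; apply; rewrite ler_nat.
have h1 : k.+1%:R * N0 <= k.+1%:R * N (cinv c x) by rewrite ler_pM2l ?ltr0n //; exact: xNP.
have h2 : L0 <= L (cinv c x) by exact: xLP.
have h3 : - L0 <= `|L0| by rewrite -normrN ler_norm.
lra.
Qed.

Lemma laplacian_chart_max (h : M -> R) (z : 'rV[R]_n) (r : R) : W z -> 0 < r ->
  smooth_fun U h ->
  (forall x, W x -> `|x - z| < r -> (h \o cinv c) x <= (h \o cinv c) z) ->
  laplacian lc e h (cinv c z) <= 0.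
Proof.
move=> Wz r0 hs hmax; have [Uq zE] := cU Wz; have [es _] := eU.
pose V := interior [set q | U q /\ `|cmap c q - z| < r].
have oV : open V by exact: open_interior.
have VU : V `<=` U by move=> q /interior_subset [].
have Vz : V (cinv c z).
  apply: filterI; first exact: open_nbhs_nbhs.
  have := cmap_continuous (Uc Uq); rewrite /prop_for /continuous_at zE.
  move=> /(_ [set x | `|x - z| < r]); apply.
  apply/nbhs_ballP; exists r => //= x; rewrite -ball_normE /=.
  by rewrite distrC.
apply: (laplacian_max lc oV Vz) => [i||q /interior_subset [Uq' qz]].
- exact: smooth_vf_subset VU (es i).
- exact: smooth_fun_subset VU hs.
have := hmax (cmap c q) _ qz; rewrite /= cmapK; last exact: Uc.
by apply; exists q => //; split=> //; exact: Uc.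
Qed.

(* Hopf: at a point [y1] where the set of maximum points is touched from outside by a ball,
   adding a small multiple of the barrier of that ball creates an interior local maximum at
   which the Laplacian is positive. *)
Lemma no_touching_ball (m : R) (x1 y1 : 'rV[R]_n) (r : R) : 0 < r -> x1 != y1 ->
  (forall x, `|x - y1| <= r -> W x) ->
  (forall x, `|x - y1| <= r -> (f \o cinv c) x <= m) ->
  (f \o cinv c) y1 = m ->
  (forall x, `|x - y1| <= r -> sqdist x x1 < sqdist y1 x1 -> (f \o cinv c) x < m) ->
  False.
Proof.
move=> r0 xy1 rW rm y1m inm.
pose x0 := 2^-1 *: (x1 + y1).
have x0y1 : x0 != y1.
  apply: contra_neq xy1 => /rowP xy; apply/rowP => j.
  by have := xy j; rewrite !mxE => E; lra.
(* The bound by [r] keeps the ball [A] about [y1] inside [W]; the bound by half the distance to [x0]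
   keeps [x0] out of [A], as the gradient of the barrier vanishes there. *)
pose t := Num.min r (`|x0 - y1| / 2).
have x0y10 : 0 < `|x0 - y1| by rewrite normr_gt0 subr_eq0.
have t0 : 0 < t by rewrite lt_min r0 divr_gt0.
have tr : t <= r by rewrite ge_min lexx.
pose A := [set x : 'rV[R]_n | `|x - y1| <= t].
have Ay1 : A y1 by rewrite /A /= subrr normr0 ltW.
have cA : compact A by exact: compact_norm_ball.
have Ar x : A x -> `|x - y1| <= r by move=> /le_trans; apply.
have AW : A `<=` W by move=> x /Ar/rW.
have Ax0 : ~ A x0.
  rewrite /A /= => h; have : `|x0 - y1| <= `|x0 - y1| / 2.
    by apply: le_trans h _; rewrite ge_min lexx orbT.
  lra.
have [K [k Kk]] := barrier_exponent (ex_intro _ y1 Ay1) cA AW Ax0.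
pose w := barrier c x0 K.
have ws : smooth_fun U w by apply: smooth_fun_subset Uc _; exact: smooth_barrier.
have wE x : A x -> w (cinv c x) = K - sqdist x x0.
  by move=> /AW/cU[_ xE]; rewrite /w /barrier xE.
(* The part of the boundary of [A] in the closed inner ball about [x0]. It avoids [y1], the only
   point where that ball meets the outer sphere, so [f < m] on it, by a uniform gap [d] thanks to
   compactness. *)
pose C1 := A `&` ([set x | t <= `|x - y1|] `&` [set x | sqdist x x0 <= sqdist y1 x0]).
have fA x : A x -> {for x, continuous (f \o cinv c)}.
  by move=> /AW; exact: W_continuous.
have cC1 : compact C1.
  apply: (subclosed_compact _ cA) => [|x []//].
  exact: closedI (closed_norm_ball y1 t)
    (closedI (closed_norm_ge y1 t) (closed_sqdist_le x0 (sqdist y1 x0))).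
have [d d0 dP] : exists2 d, 0 < d & forall x, C1 x -> (f \o cinv c) x <= m - d.
  apply: compact_lt_gap => // x [Ax].
    by move=> _; exact: fA.
  move=> [tx xx0]; apply: inm; first exact: Ar.
  apply: sqdist_inner_ball xx0.
  by apply/eqP => xy; move: tx; rewrite xy /= subrr normr0 leNgt t0.
have K0 : 0 < K by case: (Kk _ Ay1) => + _; have := sqdist_ge0 y1 x0; lra.
(* Since [w <= K] on [A], the perturbation [eps * w ^+ k.+2] never exceeds the gap [d]. *)
pose eps := d / K ^+ k.+2.
have eps0 : 0 < eps by rewrite divr_gt0 // exprn_gt0.
pose H q := f q + eps * w q ^+ k.+2.
have Hs : smooth_fun U H.
  apply: smooth_funD => //; apply: smooth_funM => //; first exact: smooth_fun_cst.
  exact: smooth_funX.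
have [z Az zP] := compact_argmax (ex_intro _ y1 Ay1) cA (fun x Ax => W_continuous Hs (AW _ Ax)).
have [es _] := eU.
have Wz := AW _ Az; have [Uz zE] := cU Wz.
have wpos x : A x -> 0 < w (cinv c x) by move=> Ax; rewrite wE //; case: (Kk _ Ax).
(* The maximum of [H] on [A] is not on the boundary: on [C1] the gap gives [H z <= m < H y1], and
   outside the inner ball the barrier is smaller at [z] than at [y1] while [f z <= m]. *)
have zt : `|z - y1| < t.
  rewrite ltNge; apply/negP => tz; have := zP _ Ay1; rewrite /= /H.
  rewrite -[f (cinv c y1)]/((f \o cinv c) y1) y1m leNgt => /negP; apply.
  have [zx0|zx0] := leP (sqdist z x0) (sqdist y1 x0).
    have fz : f (cinv c z) <= m - d by apply: dP.
    have wz : eps * w (cinv c z) ^+ k.+2 <= d.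
      rewrite /eps mulrAC ler_pdivrMr ?exprn_gt0 // ler_pM2l //.
      rewrite lerXn2r ?nnegrE ?(ltW (wpos _ Az)) ?(ltW K0) // wE //.
      by have := sqdist_ge0 z x0; lra.
    have wy : 0 < eps * w (cinv c y1) ^+ k.+2 by rewrite mulr_gt0 // exprn_gt0 // wpos.
    lra.
  have fz : f (cinv c z) <= m by apply: rm; exact: Ar.
  have wz : eps * w (cinv c z) ^+ k.+2 < eps * w (cinv c y1) ^+ k.+2.
    rewrite ltr_pM2l // ltr_pXn2r ?nnegrE ?(ltW (wpos _ Az)) ?(ltW (wpos _ Ay1)) //.
    by rewrite !wE // ltrD2l ltrN2.
  lra.
have : laplacian lc e H (cinv c z) <= 0.
  apply: (laplacian_chart_max (r := t - `|z - y1|)) => //; first by rewrite subr_gt0.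
  move=> x _ xz; apply: zP; rewrite /A /= -(subrKA z).
  by rewrite (le_trans (ler_normD _ _)) // ltW // -ltrBrDr.
have wsX : smooth_fun U (fun q => w q ^+ k.+2) by exact: smooth_funX.
rewrite (laplacianD _ oU Uz es fs); last by apply: smooth_funM => //; exact: smooth_fun_cst.
rewrite (laplacianZ _ _ oU Uz es wsX).
have := flap Uz; case: (Kk _ Az) => _ L.
have : 0 < eps * laplacian lc e (fun q => w q ^+ k.+2) (cinv c z) by rewrite mulr_gt0.
lra.
Qed.

(** If [f] were below [m] at a point [x] near [a0], a maximum point [y1] nearest to [x] would lie on
    the boundary of a ball about [x] free of maximum points, which [no_touching_ball] excludes. *)
Lemma local_strong_maximum p : U p -> (forall q, U q -> f q <= f p) ->
  \forall q \near p, f q = f p.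
Proof.
move=> Up fmax; have cp := Uc Up.
pose a0 := cmap c p; pose m := f p.
have oW : open W by exact: open_cimg.
have Wa0 : W a0 by exists p.
(* Radius [2 * s] leaves room: for [x] within [s] of [a0], the nearest maximum point [y1] is within
   [s] of [x], hence strictly inside the large ball, and a small ball about [y1] stays there. *)
have [s s0 sW] : exists2 s : R, 0 < s & forall x, `|x - a0| <= 2 * s -> W x.
  have /nbhs_ballP[r /= r0 rP] : nbhs a0 W by exact: open_nbhs_nbhs.
  exists (r / 4); first by rewrite divr_gt0.
  move=> x xr; apply: rP; rewrite -ball_normE /= distrC; apply: le_lt_trans xr _; lra.
have Wm x : W x -> (f \o cinv c) x <= m by move=> /cU[Uq _]; exact: fmax.
have a0m : (f \o cinv c) a0 = m by rewrite /= cmapK.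
suff H x : sqdist x a0 < s ^+ 2 -> (f \o cinv c) x = m.
  have : \forall q \near p, sqdist (cmap c q) a0 < s ^+ 2.
    have : {for p, continuous (sqdist^~ a0 \o cmap c)}.
      apply: continuous_comp; [exact: cmap_continuous|exact: sqdist_continuous].
    move=> /cvgr_lt; rewrite /= sqdistxx; apply; exact: exprn_gt0.
  have : \forall q \near p, cdom c q by apply: open_nbhs_nbhs; split=> //; exact: cdom_open.
  by apply: filterS2 => q cq /H /=; rewrite cmapK.
move=> xs; apply: contrapT => fx.
have xa0 := norm_lt_sqdist s0 xs.
pose Kb := [set y : 'rV[R]_n | `|y - a0| <= 2 * s].
pose Z := Kb `&` [set y | (f \o cinv c) y = m].
have KbW : Kb `<=` W by exact: sW.
have cZ : compact Z.
  apply: (subclosed_compact _ (compact_norm_ball a0 (2 * s))) => [|y []//].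
  apply: (closedI_preimage (C := [set t | t = m])) => [||y /KbW].
  - exact: closed_norm_ball.
  - exact: closed_eq.
  - exact: W_continuous.
have Za0 : Z a0 by split=> //; rewrite /Kb /= subrr normr0; lra.
have [y1 [Ky1 y1m] y1P] := compact_argmin (ex_intro _ a0 Za0) cZ
  (fun y _ => @sqdist_continuous _ _ x y).
have y1x : sqdist y1 x < s ^+ 2.
  by apply: le_lt_trans xs; rewrite [leRHS]sqdistC; exact: y1P.
have y1a0 : `|y1 - a0| < 2 * s.
  rewrite -(subrKA x) (le_lt_trans (ler_normD _ _)) //.
  have := norm_lt_sqdist s0 y1x; lra.
have inK y : `|y - y1| <= 2 * s - `|y1 - a0| -> Kb y.
  move=> yr; rewrite /Kb /= -(subrKA y1) (le_trans (ler_normD _ _)) //; lra.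
apply: (@no_touching_ball m x y1 (2 * s - `|y1 - a0|)) => //.
- by rewrite subr_gt0.
- by apply/eqP => xy; apply: fx; rewrite xy.
- by move=> y /inK/KbW.
- by move=> y /inK/KbW/Wm.
move=> y /inK Ky yx; rewrite lt_def Wm ?andbT; last exact: KbW.
apply/eqP => /esym fy; have : Z y by split.
by move=> /y1P; rewrite leNgt yx.
Qed.

End Hopf.

(** * Subharmonic functions on a compact manifold *)

Section GlobalMaximum.
Context {R : realType} {n : nat} {M : manifold R n}.

Lemma smooth_fun_continuous_manifold (U : set M) (f : M -> R) p : open U -> U p ->
  smooth_fun U f -> {for p, continuous f}.
Proof.
move=> oU Up fs; set c := chart_at p; have cp : cdom c p := cdom_chart_at p.
have : {for p, continuous ((f \o cinv c) \o cmap c)}.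
  apply: continuous_comp; first exact: cmap_continuous.
  exact: smooth_fun_continuous fs (atlas_chart_at p) Up cp.
apply: near_eq_continuous_at; apply: near_open (@cdom_open _ _ _ c) cp _ => q cq.
by rewrite /= cmapK.
Qed.

(* Along a segment on which [f] decreases from a value above [m] to [m], the mean value theorem
   yields a point with nonzero derivative where [f] is still above [m]. *)
Lemma exists_not_locally_cst (c : chart R n M) (U : set M) (f : M -> R)
    (x y : 'rV[R]_n) : atlas c -> open U -> smooth_fun U f ->
  (forall t : R, 0 <= t <= 1 -> (cmap c @` (U `&` cdom c)) (t *: (y - x) + x)) ->
  f (cinv c y) < f (cinv c x) ->
  exists2 q, f (cinv c y) < f q & ~ \forall q' \near q, f q' = f q.
Proof.
move=> ac oU fs segW fyx; set W := cmap c @` _ in segW.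
have oW : open W by exact: open_cimg.
have FC : class_C 1 W (f \o cinv c) by exact: fs.
pose v := y - x; pose m := f (cinv c y).
pose G (t : R) := (f \o cinv c) (t *: v + x).
pose G1 (t : R) := \sum_j v 0 j * 'D_(delta_mx 0 j) (f \o cinv c) (t *: v + x).
have Gd (t : R) : 0 <= t <= 1 -> is_derive t (1 : R) G (G1 t).
  by move=> /segW Wt; apply: is_derive_lineE; exact: (class_C_is_derive v oW Wt FC).
have Gc (t : R) : 0 <= t <= 1 -> {for t, continuous G}.
  by move=> /Gd[/derivable1_diffP/differentiable_continuous].
have G0 : G 0 = f (cinv c x) by rewrite /G scale0r add0r.
have G1m : G 1 = m by rewrite /G scale1r subrK.
pose T := `[0, 1]%classic `&` G @^-1` [set t | t <= m].
have cT : compact T.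
  apply: (subclosed_compact _ (@segment_compact R 0 1)) => [|t []//].
  apply: closedI_preimage; [exact: itv_closed|exact: closed_le|].
  by move=> t; rewrite /= in_itv /=; exact: Gc.
have T1 : T 1 by split; rewrite /= ?in_itv /= ?ler01 ?lexx // G1m.
(* [t1] is the first time at which [G] is at most [m], so a mean value point strictly before [t1]
   still has value above [m]. *)
have [t1 [t1in Gt1] t1P] := compact_argmin (f := @id R) (ex_intro _ 1 T1) cT
  (fun t _ (B : set R) (tB : nbhs (id t) B) => tB).
move: t1in; rewrite /= in_itv /= => /andP[t10 t11].
have {}t10 : 0 < t1.
  rewrite lt_neqAle t10 andbT; apply/eqP => t1E; move: Gt1; rewrite /= -t1E G0.
  by rewrite leNgt fyx.
have sub (s : R) : s \in `[0, t1] -> 0 <= s <= 1.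
  by rewrite in_itv /= => /andP[-> st]; exact: le_trans st t11.
have [||s sin E] := @MVT R G G1 0 t1 t10.
- by move=> s sin; apply/Gd/sub; exact: subset_itv_oo_cc sin.
- by apply: derivable_within_continuous => s /sub/Gd[].
have s01 : 0 <= s <= 1 by apply: sub; exact: subset_itv_oo_cc sin.
move: sin; rewrite in_itv /= => /andP[s0 st1].
have [q [Uq cq] qE] := segW s s01.
have Gs : G s = f q by rewrite /G /= -qE cmapK.
exists q.
  rewrite -Gs ltNge; apply/negP => Gsm; have : T s by split; rewrite //= in_itv.
  by move=> /t1P; rewrite leNgt st1.
move=> loc; have : G1 s < 0.
  rewrite -(pmulr_llt0 _ t10) -[X in _ * X]subr0 -E subr_lt0 G0.
  exact: le_lt_trans Gt1 fyx.
suff -> : G1 s = 0 by rewrite ltxx.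
have : \forall z \near cmap c q, (f \o cinv c) z = f q.
  have := cinv_continuous cq; rewrite /prop_for /continuous_at cmapK // => /(_ _ loc).
  exact.
rewrite qE => near_q.
have lc : {for s, continuous (fun t : R => t *: v + x)}.
  by apply: (@derivable_continuous_line _ _ _ id x v); exact: derivable_id.
have [_ <-] := Gd s s01.
have [_ ->] // : is_derive s (1 : R) G 0.
apply: (near_eq_is_derive (f := cst (G s))).
have H : nbhs s [set t | (f \o cinv c) (t *: v + x) = f q] by exact: lc near_q.
by apply: filterS H => t /= H; rewrite Gs.
Qed.

Context {g : riemannian_metric M} (lc : levi_civita g).

Theorem subharmonic_locally_cst (f : M -> R) : compact [set: M] ->
  smooth_fun [set: M] f ->
  (forall p, 0 <= laplacian lc (orthonormal_frame_at g p) f p) ->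
  forall p, \forall q \near p, f q = f p.
Proof.
move=> cM fs flap p; apply: contrapT => pN.
pose N := [set p | ~ \forall q \near p, f q = f p].
have cN : compact N.
  apply: (subclosed_compact _ cM) => // q clq; rewrite /N /= => nq.
  have /clq [q' [Nq' loc]] : nbhs q (interior [set z | f z = f q]).
    exact: nbhs_interior.
  by apply: Nq'; apply: (filterS _ loc) => z ->; rewrite (nbhs_singleton loc).
have fc q : {for q, continuous f}.
  exact: (smooth_fun_continuous_manifold openT).
have [q qN qmax] := compact_argmax (ex_intro _ p pN) cN (fun q _ => fc q).
have [U [oU Uq eU]] := orthonormal_frame_atP g q.
set e := orthonormal_frame_at g q in eU.
set c := chart_at q; have ac : atlas c := atlas_chart_at q.
have cq : cdom c q := cdom_chart_at q.
pose W := cmap c @` (U `&` cdom c).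
have /nbhs_ballP[r /= r0 rW] : nbhs (cmap c q) W.
  by apply: open_nbhs_nbhs; split; [exact: open_cimg|exists q].
(* Chart images of points of [V] lie in a ball about [cmap c q], which is convex: segments to the
   centre stay in the chart image. *)
pose V := interior [set q' | [/\ U q', cdom c q' & ball (cmap c q) r (cmap c q')]].
have VP q' : V q' -> [/\ U q', cdom c q' & ball (cmap c q) r (cmap c q')].
  exact: interior_subset.
have oV : open V by exact: open_interior.
have Vq : V q.
  have H1 : \forall q' \near q, ball (cmap c q) r (cmap c q').
    by apply: (cmap_continuous cq); exact: nbhsx_ballx.
  have H2 : \forall q' \near q, U q' by exact: open_nbhs_nbhs.
  have H3 : \forall q' \near q, cdom c q'.
    by apply: open_nbhs_nbhs; split=> //; exact: cdom_open.
  by apply: filterS3 H1 H2 H3.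
have VU : V `<=` U by move=> q' /VP[].
apply: qN; apply: (local_strong_maximum ac oV _ (e := e) (lc := lc) (f := f)) => //.
- by move=> q' /VP[].
- have [es eo] := eU; split=> [i|q' /VU]; last exact: eo.
  exact: smooth_vf_subset VU (es i).
- exact: smooth_fun_subset fs.
(* The hypothesis at [q'] is in the frame chosen at [q'], whereas Hopf's argument uses the frame
   chosen at [q] on all of [V]. *)
- move=> q' Vq'; have [U' [oU' Uq' [es' eo']]] := orthonormal_frame_atP g q'.
  have [es eo] := eU.
  have oVU : open (V `&` U') by exact: openI.
  rewrite (laplacian_frame_indep lc (U := V `&` U') (e' := orthonormal_frame_at g q')) //.
  + split=> [i|z [/VU]]; last by move=> Uz _; exact: eo.
    by apply: smooth_vf_subset (es i) => z [/VU].
  + split=> [i|z [_]]; last exact: eo'.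
    by apply: smooth_vf_subset (es' i) => z [].
  + exact: smooth_fun_subset fs.
(* A point [q'] of [V] with [f q < f q'] would give, on the segment from [q'] to [q], a point of [N]
   with value above [f q], the maximum of [f] on [N]. *)
move=> q' /VP[Uq' cq' qb]; rewrite leNgt; apply/negP => fq.
have [|||z fz /qmax] := @exists_not_locally_cst c U f (cmap c q') (cmap c q) ac oU.
- exact: smooth_fun_subset fs.
- move=> t /andP[t0 t1]; apply: rW; move: qb; rewrite -!ball_normE /= => qb.
  have -> : cmap c q - (t *: (cmap c q - cmap c q') + cmap c q') =
      (1 - t) *: (cmap c q - cmap c q').
    by apply/rowP => j; rewrite !mxE; ring.
  rewrite normrZ ger0_norm ?subr_ge0 //; apply: le_lt_trans qb.
  by rewrite ler_piMl // gerBl.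
- by rewrite !cmapK.
by rewrite cmapK // in fz; rewrite leNgt fz.
Qed.

End GlobalMaximum.

(** * Dirac bundles *)

(** Separates the trace of the Hessian from the pairs [i < j] that combine into curvature. *)
Lemma sum_offdiag (V : zmodType) n (F : 'I_n -> 'I_n -> V) :
  \sum_i \sum_j F i j =
  \sum_i F i i + \sum_(i < n) \sum_(j < n | (i < j)%N) (F i j + F j i).
Proof.
under [X in _ = _ + X]eq_bigr do rewrite big_split /=.
rewrite big_split /= [X in _ + (_ + X)](exchange_big_dep xpredT) //= addrA -!big_split /=.
apply: eq_bigr => i _; rewrite (bigD1 i) //= -addrA; congr (_ + _).
rewrite (bigID (fun j : 'I_n => (i < j)%N)) /=; congr (_ + _); apply: eq_bigl => j.
  by rewrite -val_eqE /= neq_ltn; case: ltngtP.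
by rewrite -val_eqE /= neq_ltn; case: ltngtP.
Qed.

Section DiracAlgebra.
Context {R : realType} {n : nat} {M : manifold R n}.
Context {g : riemannian_metric M} {lc : levi_civita g} {Cl : clifford_bundle lc}.
Context (S : dirac_bundle Cl).
Let gm : fiber_metric (@smooth_vf R n M) g := rmet_metric g.
Let hm := db_fiber_metric S.
Let lcc : connection (@smooth_vf R n M) lc := (lc_metric lc).1.
Let nc : connection (smooth_section (db_frames S)) (db_nabla S) := (db_connection S).1.
Local Notation nabla := (db_nabla S).
Local Notation h := (@db_metric _ _ _ _ _ _ S _).

Lemma cmul_linearl p a (u v : tangent p) (s : S p) :
  cmul (a *: u + v) s = a *: cmul u s + cmul v s.
Proof. by rewrite /cmul linearP; exact: (act_linearl (db_module S p)). Qed.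

Lemma cmul_linearr p a (v : tangent p) (s t : S p) :
  cmul v (a *: s + t) = a *: cmul v s + cmul v t.
Proof. exact: (act_linearr (db_module S p)). Qed.

Lemma cmul0l p (s : S p) : cmul 0 s = 0.
Proof.
by have := cmul_linearl 1 0 0 s; rewrite scaler0 addr0 scale1r => /addrr_eq0.
Qed.

Lemma cmul0r p (v : tangent p) : cmul v (0 : S p) = 0.
Proof.
by have := cmul_linearr 1 v 0 0; rewrite scaler0 addr0 scale1r => /addrr_eq0.
Qed.

Lemma cmulDl p (u v : tangent p) (s : S p) : cmul (u + v) s = cmul u s + cmul v s.
Proof. by have := cmul_linearl 1 u v s; rewrite !scale1r. Qed.

Lemma cmulDr p (v : tangent p) (s t : S p) : cmul v (s + t) = cmul v s + cmul v t.
Proof. by have := cmul_linearr 1 v s t; rewrite !scale1r. Qed.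

Lemma cmulZl p a (v : tangent p) (s : S p) : cmul (a *: v) s = a *: cmul v s.
Proof. by have := cmul_linearl a v 0 s; rewrite !addr0 cmul0l addr0. Qed.

Lemma cmulZr p a (v : tangent p) (s : S p) : cmul v (a *: s) = a *: cmul v s.
Proof. by have := cmul_linearr a v s 0; rewrite !addr0 cmul0r addr0. Qed.

Lemma cmulNr p (v : tangent p) (s : S p) : cmul v (- s) = - cmul v s.
Proof. by rewrite -scaleN1r cmulZr scaleN1r. Qed.

Lemma cmul_suml p I (r : seq I) (v : I -> tangent p) (s : S p) :
  cmul (\sum_(i <- r) v i) s = \sum_(i <- r) cmul (v i) s.
Proof.
by apply: (big_rec2 (fun x y => cmul x s = y)) => [|i x y _ <-]; rewrite ?cmul0l ?cmulDl.
Qed.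

Lemma cmul_sumr p I (r : seq I) (v : tangent p) (s : I -> S p) :
  cmul v (\sum_(i <- r) s i) = \sum_(i <- r) cmul v (s i).
Proof.
by apply: (big_rec2 (fun x y => cmul v x = y)) => [|i x y _ <-]; rewrite ?cmul0r ?cmulDr.
Qed.

Lemma cmul_sqr p (v : tangent p) (s : S p) : cmul v (cmul v s) = - (g p v v) *: s.
Proof.
have dm := db_module S p; have [sq _] := cl_clifford Cl p.
rewrite /cmul -(act_mul dm) sq.
have /= E0 := act_linearl dm s 1 0 0.
have z : db_act (0 : Cl p) s = 0.
  by move: E0; rewrite scaler0 addr0 scale1r => /addrr_eq0.
have /= := act_linearl dm s (- g p v v) 1 0.
by rewrite addr0 z addr0 (act_one dm).
Qed.

(** Polarization of [cmul_sqr] at [u + v]. *)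
Lemma cmul_anticomm p (u v : tangent p) (s : S p) : g p u v = 0 ->
  cmul u (cmul v s) = - cmul v (cmul u s).
Proof.
move=> uv; have := cmul_sqr (u + v) s.
have -> : g p (u + v) (u + v) = g p u u + g p v v.
  by rewrite (fm_Dl gm) !(fm_Dr gm) (fm_sym gm v) uv add0r addr0.
rewrite opprD scalerDl !cmulDl !cmulDr !cmul_sqr.
rewrite [X in _ + X = _]addrC addrACA -[RHS]addr0 => /addrI /eqP.
by rewrite addr_eq0 => /eqP.
Qed.

Lemma cmul_skew p (v : tangent p) (s t : S p) : h (cmul v s) t = - h s (cmul v t).
Proof. by apply/eqP; rewrite -addr_eq0 /cmul db_skew. Qed.

(* The second covariant derivative of [sigma] in the directions [e i] and [e j]. *)
Definition hessian (e : 'I_n -> vector_field M) (sigma : forall q, S q) p i j : S p :=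
  nabla p (e i p) (fun q => nabla q (e j q) sigma) - nabla p (lc p (e i p) (e j)) sigma.

Context {U : set M} (oU : open U).

Lemma nabla_cst p (v : tangent p) a (s : forall q, S q) : U p ->
  smooth_section (db_frames S) U s ->
  nabla p v (fun q => a *: s q) = a *: nabla p v s.
Proof.
move=> Up ss; rewrite (cn_leibniz nc v oU Up (smooth_fun_cst U a) ss).
by rewrite tderive_cst scale0r add0r.
Qed.

Lemma nabla_sum p (v : tangent p) m (s : 'I_m -> forall q, S q) : U p ->
  (forall i, smooth_section (db_frames S) U (s i)) ->
  nabla p v (fun q => \sum_i s i q) = \sum_i nabla p v (s i).
Proof.
move=> Up; elim: m s => [|m IH] s ss.
  rewrite big_ord0; have := nabla_cst v 0 Up (@smooth_section0 _ _ _ _ (db_frames S) U).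
  rewrite scale0r => <-.
  apply: (cn_local nc v oU Up).
    apply: smooth_section_congr (@smooth_section0 _ _ _ _ (db_frames S) U) => q _.
    by rewrite big_ord0.
  by move=> q _; rewrite big_ord0 scaler0.
rewrite big_ord_recl -IH => [|i]; last exact: ss.
have ss' : smooth_section (db_frames S) U (fun q => \sum_(i < m) s (lift ord0 i) q).
  by apply: smooth_section_sum => // i; exact: ss.
rewrite -(cn_add nc v oU Up (ss ord0) ss').
apply: (cn_local nc v oU Up) => [|q _]; first exact: smooth_section_sum.
by rewrite big_ord_recl.
Qed.

Lemma nablaD p (u v : tangent p) s : U p -> smooth_section (db_frames S) U s ->
  nabla p (u + v) s = nabla p u s + nabla p v s.
Proof. by move=> Up ss; have := cn_linear nc 1 u v oU Up ss; rewrite !scale1r. Qed.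

Lemma nabla0 p s : U p -> smooth_section (db_frames S) U s ->
  nabla p 0 s = 0.
Proof.
by move=> Up ss; have := cn_linear nc 1 0 0 oU Up ss;
  rewrite scaler0 addr0 scale1r => /addrr_eq0.
Qed.

Lemma nablaZ p a (v : tangent p) s : U p -> smooth_section (db_frames S) U s ->
  nabla p (a *: v) s = a *: nabla p v s.
Proof.
by move=> Up ss; have := cn_linear nc a v 0 oU Up ss; rewrite !addr0 nabla0 // addr0.
Qed.

Lemma nablaB p (u v : tangent p) s : U p -> smooth_section (db_frames S) U s ->
  nabla p (u - v) s = nabla p u s - nabla p v s.
Proof. by move=> Up ss; rewrite -scaleN1r nablaD // nablaZ // scaleN1r. Qed.

Lemma nabla_suml p I (r : seq I) (v : I -> tangent p) s : U p ->
  smooth_section (db_frames S) U s ->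
  nabla p (\sum_(i <- r) v i) s = \sum_(i <- r) nabla p (v i) s.
Proof.
move=> Up ss.
by apply: (big_rec2 (fun x y => nabla p x s = y)) => [|i x y _ <-]; rewrite ?nabla0 ?nablaD.
Qed.

Lemma smooth_cmul X s : smooth_vf U X -> smooth_section (db_frames S) U s ->
  smooth_section (db_frames S) U (fun q => cmul (X q) (s q)).
Proof.
move=> Xs ss; apply: (db_act_smooth oU) => //; exact: cl_iota_smooth.
Qed.

Lemma nabla_cmul p (v : tangent p) X s : U p -> smooth_vf U X ->
  smooth_section (db_frames S) U s ->
  nabla p v (fun q => cmul (X q) (s q)) =
  cmul (lc p v X) (s p) + cmul (X p) (nabla p v s).
Proof.
move=> Up Xs ss; rewrite /cmul (db_nabla_act _ oU Up) //; last exact: cl_iota_smooth.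
by rewrite (cl_nabla_iota _ _ oU Up).
Qed.

Context {e : 'I_n -> vector_field M} (eU : local_orthonormal_frame g U e).
Context {sigma : forall q, S q} (ss : smooth_section (db_frames S) U sigma).
Let es i : smooth_vf U (e i) := eU.1 i.
Let eo q : U q -> orthonormal g (fun i => e i q) := eU.2 q.
Let dS i q := nabla q (e i q) sigma.
Let dSs i : smooth_section (db_frames S) U (dS i).
Proof. exact: (cn_smooth nc oU (es i) ss). Qed.

Lemma cmul_frame_sqr p i (s : S p) : U p -> cmul (e i p) (cmul (e i p) s) = - s.
Proof. by move=> Up; rewrite cmul_sqr (eo Up i i) eqxx scaleN1r. Qed.

Lemma cmul_frame_anticomm p i j (s : S p) : U p -> i != j ->
  cmul (e i p) (cmul (e j p) s) = - cmul (e j p) (cmul (e i p) s).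
Proof. by move=> Up ij; rewrite cmul_anticomm // (eo Up i j) (negbTE ij). Qed.

(** Torsion-freeness turns the bracket term of the curvature into the difference of the two Hessian
    corrections. *)
Lemma curvature_hessian p i j : U p ->
  curvature nabla (e i) (e j) sigma p = hessian e sigma p i j - hessian e sigma p j i.
Proof.
move=> Up; rewrite /curvature /hessian -(lc_torsion_free lc oU Up (es i) (es j)).
rewrite nablaB // !opprB -!addrA; congr (_ + _).
by rewrite addrCA [RHS]addrCA; congr (_ + _); rewrite addrC.
Qed.

Lemma lc_frame_skew p (v : tangent p) j k : U p ->
  g p (lc p v (e j)) (e k p) = - g p (lc p v (e k)) (e j p).
Proof.
move=> Up; apply/eqP; rewrite -addr_eq0 [X in _ + X](fm_sym gm).
rewrite -((lc_metric lc).2 U) //.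
rewrite (tderive_congr _ oU Up (g := fun=> (j == k)%:R : R)) ?tderive_cst // => q Uq.
exact: eo.
Qed.

(** In terms of the coefficients [g (nabla_v e_j) e_k], exchanging [j] and [k] in the second sum
    makes each coefficient meet its transpose, and they are skew by [lc_frame_skew]. This does the
    work of a frame with [nabla e = 0] at [p]. *)
Lemma frame_connection_cancel p (v : tangent p) : U p ->
  \sum_j (cmul (lc p v (e j)) (nabla p (e j p) sigma) +
          cmul (e j p) (nabla p (lc p v (e j)) sigma)) = 0.
Proof.
move=> Up; rewrite big_split /=.
have -> : \sum_j cmul (lc p v (e j)) (nabla p (e j p) sigma) =
    \sum_j \sum_k g p (lc p v (e j)) (e k p) *: cmul (e k p) (nabla p (e j p) sigma).
  apply: eq_bigr => j _; rewrite [X in cmul X _](orthonormal_expand _ (eo Up)).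
  by rewrite cmul_suml; apply: eq_bigr => k _; rewrite cmulZl.
have -> : \sum_j cmul (e j p) (nabla p (lc p v (e j)) sigma) =
    \sum_j \sum_k g p (lc p v (e j)) (e k p) *: cmul (e j p) (nabla p (e k p) sigma).
  apply: eq_bigr => j _; rewrite [X in nabla p X _](orthonormal_expand _ (eo Up)).
  rewrite nabla_suml // cmul_sumr; apply: eq_bigr => k _.
  by rewrite nablaZ // cmulZr.
rewrite [X in _ + X]exchange_big /= -big_split big1 //= => j _.
rewrite -big_split big1 //= => k _.
by rewrite -scalerDl (lc_frame_skew _ _ _ Up) addNr scale0r.
Qed.

Lemma dirac_square_hessian p : U p ->
  \sum_i cmul (e i p) (nabla p (e i p)
     (fun q => \sum_j cmul (e j q) (nabla q (e j q) sigma))) =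
  \sum_i \sum_j cmul (e i p) (cmul (e j p) (hessian e sigma p i j)).
Proof.
move=> Up; apply: eq_bigr => i _; rewrite -cmul_sumr; congr cmul.
rewrite nabla_sum // => [|j]; last exact: smooth_cmul (dSs j).
(* The vanishing sum added here collects the derivatives of the frame from the Leibniz rule and the
   correction terms of [hessian]. *)
rewrite -[RHS]add0r -[X in _ = X + _](frame_connection_cancel (e i p) Up) -big_split /=.
apply: eq_bigr => j _; rewrite (nabla_cmul _ Up (es j) (dSs j)) /hessian -/(dS j p).
by rewrite cmulDr cmulNr addrACA addrN addr0.
Qed.

(* [D^2 = - tr (nabla^2) + R] *)
Lemma weitzenbock_formula p : U p ->
  \sum_i cmul (e i p) (nabla p (e i p)
     (fun q => \sum_j cmul (e j q) (nabla q (e j q) sigma))) =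
  - (\sum_i hessian e sigma p i i) +
  \sum_(i < n) \sum_(j < n | (i < j)%N)
    cmul (e i p) (cmul (e j p) (curvature nabla (e i) (e j) sigma p)).
Proof.
move=> Up; rewrite dirac_square_hessian // sum_offdiag -sumrN; congr (_ + _).
  by apply: eq_bigr => i _; rewrite cmul_frame_sqr.
(* Anticommutation turns [e_i e_j H_ij + e_j e_i H_ji] into [e_i e_j (H_ij - H_ji)], whose last
   factor is the curvature. *)
apply: eq_bigr => i _; apply: eq_bigr => j ij.
rewrite curvature_hessian //; move: (hessian e sigma p i j) (hessian e sigma p j i) => hij hji.
rewrite !cmulDr !cmulNr; congr (_ + _).
by apply: cmul_frame_anticomm; rewrite // -val_eqE /= gtn_eqF.
Qed.

(** Metric compatibility is applied twice along [e i]; the first-order correction of [laplacian]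
    becomes the correction inside [hessian]. *)
Lemma laplacian_norm p : U p ->
  laplacian lc e (fun q => h (sigma q) (sigma q)) p =
  2 * (\sum_i h (nabla p (e i p) sigma) (nabla p (e i p) sigma) +
       h (\sum_i hessian e sigma p i i) (sigma p)).
Proof.
move=> Up; rewrite (fm_suml hm) -big_split mulr_sumr; apply: eq_bigr => i _ /=.
have d1 q (v : tangent q) : U q ->
    tderive v (fun q => h (sigma q) (sigma q)) = 2 * h (nabla q v sigma) (sigma q).
  move=> Uq; rewrite ((db_connection S).2 _ _ _ _ _ oU Uq ss ss).
  by rewrite [X in _ + X](fm_sym hm) -mulr2n mulr_natl.
rewrite d1 // (tderive_congr _ oU Up (d1^~ (e i _))).
have fs : smooth_fun U (fun q => h (nabla q (e i q) sigma) (sigma q)).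
  exact: (fm_smooth hm oU (dSs i) ss).
rewrite (tderiveZ _ _ oU Up fs) ((db_connection S).2 _ _ _ _ _ oU Up (dSs i) ss).
rewrite -mulrBr /hessian (fm_Dl hm) -scaleN1r (fm_Zl hm) mulN1r; congr (2 * _).
by rewrite addrCA addrA.
Qed.

(** [dirac_operator] picks its frame anew at every point; a single frame over [U] is what allows
    [D sigma] to be differentiated again. *)
Lemma dirac_operator_frame p : U p ->
  dirac_operator sigma p = \sum_i cmul (e i p) (nabla p (e i p) sigma).
Proof.
move=> Up; rewrite /dirac_operator.
have [U' [_ U'p [_ eo']]] := orthonormal_frame_atP g p.
apply: (orthonormal_trace (g := g) (B := fun v w => cmul v (nabla p w sigma))
  (e := fun i => orthonormal_frame_at g p i p) (e' := fun i => e i p)) => //.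
- by move=> a u v w; exact: cmul_linearl.
- by move=> a u v w; rewrite (cn_linear nc _ _ _ oU Up ss) cmul_linearr.
- exact: eo'.
- exact: eo.
Qed.

(** Clifford multiplication by a unit vector is a skew isometry, so the cross terms sum to [2 lambda
    h (D sigma) sigma = - 2 n lambda^2 |sigma|^2] and the squares to [n lambda^2 |sigma|^2]. Under
    the Dirac equation, for [n > 0], the difference being squared is the twistor operator
    [nabla_X sigma + (1/n) X . D sigma]. *)
Lemma twistor_norm lambda p : U p ->
  dirac_operator sigma p = - (n%:R * lambda) *: sigma p ->
  \sum_i h (nabla p (e i p) sigma - lambda *: cmul (e i p) (sigma p))
           (nabla p (e i p) sigma - lambda *: cmul (e i p) (sigma p)) =
  \sum_i h (nabla p (e i p) sigma) (nabla p (e i p) sigma) -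
  n%:R * lambda ^+ 2 * h (sigma p) (sigma p).
Proof.
move=> Up D.
have E i : h (nabla p (e i p) sigma - lambda *: cmul (e i p) (sigma p))
           (nabla p (e i p) sigma - lambda *: cmul (e i p) (sigma p)) =
    h (nabla p (e i p) sigma) (nabla p (e i p) sigma) +
    (2 * lambda * h (cmul (e i p) (nabla p (e i p) sigma)) (sigma p) +
     lambda ^+ 2 * h (sigma p) (sigma p)).
  rewrite -scaleNr !(fm_Dl hm) !(fm_Dr hm) !(fm_Zl hm) !(fm_Zr hm).
  rewrite [h (cmul _ (sigma p)) (nabla _ _ _)](fm_sym hm).
  have -> : h (cmul (e i p) (sigma p)) (cmul (e i p) (sigma p)) = h (sigma p) (sigma p).
    by rewrite cmul_skew cmul_frame_sqr // -scaleN1r (fm_Zr hm) mulN1r opprK.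
  rewrite cmul_skew; ring.
under eq_bigr do rewrite E.
rewrite big_split big_split /= -mulr_sumr -(fm_suml hm) -dirac_operator_frame // D.
rewrite (fm_Zl hm) sumr_const card_ord -mulr_natl; ring.
Qed.

End DiracAlgebra.

(** * The eigenvalue equation and Killing sections *)

Section KillingSections.
Context {R : realType} {n : nat} {M : manifold R n}.
Context {g : riemannian_metric M} {lc : levi_civita g} {Cl : clifford_bundle lc}.
Context {S : dirac_bundle Cl} {U : set M} (oU : open U).
Context {e : 'I_n -> vector_field M} (eU : local_orthonormal_frame g U e).
Context {sigma : forall q, S q} (ss : smooth_section (db_frames S) U sigma).
Context {lambda : R}.
Hypothesis sigma_dirac :
  forall q, U q -> dirac_operator sigma q = - (n%:R * lambda) *: sigma q.
Let es i : smooth_vf U (e i) := eU.1 i.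
Let nc := (db_connection S).1.

(** Applying [D] twice gives [(n lambda)^2 sigma], which enters the Weitzenböck formula. The
    resulting relation serves both directions: it yields the curvature term from the trace of the
    Hessian, and the trace from the curvature term. *)
Lemma trace_hessian_eigen p : U p ->
  \sum_(i < n) \sum_(j < n | (i < j)%N)
    cmul (e i p) (cmul (e j p) (curvature (db_nabla S) (e i) (e j) sigma p)) =
  (n%:R * lambda) ^+ 2 *: sigma p + \sum_i hessian e sigma p i i.
Proof.
move=> Up; apply/eqP; rewrite -subr_eq addrC.
rewrite -(weitzenbock_formula oU eU ss Up); apply/eqP.
have dirac_section : smooth_section (db_frames S) U
    (fun q => \sum_j cmul (e j q) (db_nabla S q (e j q) sigma)).
  apply: smooth_section_sum => // j; apply: smooth_cmul => //.
  exact: (cn_smooth nc oU (es j) ss).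
transitivity (\sum_i cmul (e i p) (- (n%:R * lambda) *: db_nabla S p (e i p) sigma)).
  apply: eq_bigr => i _; congr cmul; rewrite -(nabla_cst oU _ _ Up ss).
  (* A connection depends only on germs, so the inner Dirac sum may be replaced by the multiple of
     [sigma] it equals on [U]. *)
  apply: (cn_local nc _ oU Up dirac_section) => q Uq.
  by rewrite -(dirac_operator_frame oU eU ss Uq) sigma_dirac.
under eq_bigr do rewrite cmulZr.
rewrite -scaler_sumr -(dirac_operator_frame oU eU ss Up) sigma_dirac // scalerA.
by rewrite mulrNN expr2.
Qed.

End KillingSections.

Theorem theoremC (R : realType) (n : nat) (M : manifold R n)
    (hM : compact [set: M])
    (g : riemannian_metric M) (lc : levi_civita g) (Cl : clifford_bundle lc)
    (S : dirac_bundle Cl)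
    (sigma : forall p : M, S p)
    (hsigma : smooth_section (db_frames S) [set: M] sigma)
    (lambda : R) :
  killing_section lambda sigma <->
  (forall p, dirac_operator sigma p = - (n%:R * lambda) *: sigma p) /\
  (forall p, weitzenbock_operator sigma p =
     (lambda ^+ 2 * n%:R * (n%:R - 1)) *: sigma p).
Proof.
have ss U : smooth_section (db_frames S) U sigma.
  by apply: smooth_section_subset hsigma.
have hm := db_fiber_metric S.
split=> [K|[D W]].
  have D p : dirac_operator sigma p = - (n%:R * lambda) *: sigma p.
    have [U [oU Up eU]] := orthonormal_frame_atP g p.
    rewrite /dirac_operator.
    under eq_bigr do rewrite K cmulZr (cmul_frame_sqr eU) // scalerN -scaleNr.
    by rewrite sumr_const card_ord -scaler_nat scalerA mulrN.
  split=> // p; have [U [oU Up eU]] := orthonormal_frame_atP g p.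
  rewrite /weitzenbock_operator (trace_hessian_eigen oU eU (ss U) (fun q _ => D q) Up).
  (* Differentiating [lambda e_i . sigma] gives [lambda (nabla_{e_i} e_i) . sigma], which the
     Killing equation cancels against the Hessian correction, and [lambda^2 e_i . e_i . sigma = -
     lambda^2 sigma]. *)
  have H i : hessian (orthonormal_frame_at g p) sigma p i i =
      - lambda ^+ 2 *: sigma p.
    rewrite /hessian K.
    have -> : (fun q => db_nabla S q (orthonormal_frame_at g p i q) sigma) =
        fun q => lambda *: cmul (orthonormal_frame_at g p i q) (sigma q).
      by apply: functional_extensionality_dep => q; exact: K.
    have smul := smooth_cmul oU (eU.1 i) (ss U).
    rewrite (nabla_cst oU _ _ Up smul) (nabla_cmul oU _ Up (eU.1 i) (ss U)) K cmulZr.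
    rewrite (cmul_frame_sqr eU) // scalerDr addrAC subrr add0r.
    by rewrite scalerN scalerN scalerA scaleNr expr2.
  under eq_bigr do rewrite H.
  rewrite sumr_const card_ord -[X in _ + X]scaler_nat scalerA -scalerDl; congr (_ *: _); ring.
pose f q := db_metric (sigma q) (sigma q).
have fs : smooth_fun [set: M] f by exact: (fm_smooth hm openT hsigma hsigma).
have lapf p : laplacian lc (orthonormal_frame_at g p) f p =
    2 * \sum_i db_metric
      (db_nabla S p (orthonormal_frame_at g p i p) sigma -
       lambda *: cmul (orthonormal_frame_at g p i p) (sigma p))
      (db_nabla S p (orthonormal_frame_at g p i p) sigma -
       lambda *: cmul (orthonormal_frame_at g p i p) (sigma p)).
  have [U [oU Up eU]] := orthonormal_frame_atP g p.
  rewrite (twistor_norm oU eU (ss U) Up (D p)) (laplacian_norm oU eU (ss U) Up).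
  congr (2 * (_ + _)).
  have := trace_hessian_eigen oU eU (ss U) (fun q _ => D q) Up.
  rewrite -[LHS]/(weitzenbock_operator sigma p) W => E.
  (* The value is [lambda^2 n (n - 1) - (n lambda)^2 = - n lambda^2], the constant by which
     [twistor_norm] completes the square. *)
  have -> : \sum_i hessian (orthonormal_frame_at g p) sigma p i i =
      - (n%:R * lambda ^+ 2) *: sigma p.
    apply: (addrI ((n%:R * lambda) ^+ 2 *: sigma p)).
    by rewrite -E -scalerDl; congr (_ *: _); ring.
  by rewrite (fm_Zl hm) mulNr.
have lap0 p : laplacian lc (orthonormal_frame_at g p) f p = 0.
  have loc : \forall q \near p, f q = f p.
    apply: (subharmonic_locally_cst (lc := lc) hM fs) => {}p.
    by rewrite lapf mulr_ge0 // sumr_ge0 // => i _; exact: (fm_ge0 hm).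
  apply: (@laplacian_locally_cst _ _ _ _ lc (interior [set q | f q = f p])).
  - exact: open_interior.
  - exact: loc.
  - by move=> q /interior_subset.
move=> p v; have [U [oU Up eU]] := orthonormal_frame_atP g p.
have P0 i : db_nabla S p (orthonormal_frame_at g p i p) sigma =
    lambda *: cmul (orthonormal_frame_at g p i p) (sigma p).
  apply/eqP; rewrite -subr_eq0; apply/eqP; apply: (fm_eq0 hm).
  have := lap0 p; rewrite lapf => /eqP; rewrite mulf_eq0 pnatr_eq0 /=.
  rewrite psumr_eq0 => [/allP /(_ i)|j _]; last exact: (fm_ge0 hm).
  by rewrite mem_index_enum => /(_ isT) /eqP ->.
(* Both sides of the Killing equation are linear in [v], so the equation on frame vectors
   suffices. *)
rewrite (orthonormal_expand v (eU.2 p Up)) (nabla_suml oU) // cmul_suml scaler_sumr.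
apply: eq_bigr => i _.
by rewrite (nablaZ oU) // P0 cmulZl !scalerA mulrC.
Qed.
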